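(* Let $S$ be a topological monoid and let $X$ be a circularly ordered compact (not necessarily metrizable) $S$-system. Then $X$ is Rosenthal representable as an $S$-system, and hence, in particular, $X$ is a tame $S$-system.
   Context: A circular order on a set $X$ is a relation $R\subset X^3$ (write $[a,b,c]$ for $(a,b,c)\in R$) such that: (Cyclicity) $[a,b,c]\Rightarrow[b,c,a]$; (Asymmetry) $[a,b,c]\Rightarrow (a,c,b)\notin R$; (Transitivity) $[a,b,c]$ and $[a,c,d]$ imply $[a,b,d]$; (Totality) if $a,b,c$ are distinct then $[a,b,c]$ or $[a,c,b]$. For $a\ne b$ put $(a,b)_R=\{x:[a,x,b]\}$ and $[a,b]_R=(a,b)_R\cup\{a,b\}$; put $[a,a]_R=\{a\}$. The interval topology $\tau_R$ has the sets $(a,b)_R$ as a base (if $|X|\le 2$ take the discrete topology). A map $f:X_1\to X_2$ between circularly ordered sets is c-order preserving (COP) if (1) $[a,b,c]$ and $f(a),f(b),f(c)$ distinct imply $[f(a),f(b),f(c)]$; and (2) $f(a)=f(c)$ implies $f$ is constant on one of $[a,c]_R$, $[c,a]_R$. A compact $S$-system is a compact Hausdorff space $X$ with a continuous monoid action $S\times X\to X$ (with $ex=x$) of a topological monoid $S$. It is circularly ordered if there is a circular order $R$ on $X$ such that $\tau_R$ is the topology of $X$ and every translation $x\mapsto sx$ ($s\in S$) is COP. A Banach space is Rosenthal if it contains no isomorphic copy of $\ell_1$. For a Banach space $V$ let $\Theta(V)$ be the monoid of linear operators $V\to V$ of norm at most $1$. A representation of $(S,X)$ on $V$ is a pair $(h,\alpha)$,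 where $h:S\to\Theta(V)$ is continuous for the weak operator topology and satisfies $h(st)=h(t)h(s)$, $h(e)=\mathrm{id}$, and $\alpha:X\to V^*$ is a bounded weak-star continuous map with $\langle v,\alpha(sx)\rangle=\langle h(s)v,\alpha(x)\rangle$ for all $s\in S$, $x\in X$, $v\in V$. The system $(S,X)$ is Rosenthal representable if it has a representation on some Rosenthal Banach space $V$ for which $\alpha$ is a topological embedding into $(V^*,w^* )$. A sequence of functions $f_n:X\to\mathbb{R}$ is independent if there are reals $a<b$ such that $\bigcap_{n\in P}f_n^{-1}(-\infty,a)\cap\bigcap_{n\in M}f_n^{-1}(b,\infty)\ne\emptyset$ for all finite disjoint $P,M\subset\mathbb{N}$. A compact $S$-system $X$ is tame if for every continuous $f:X\to\mathbb{R}$ the family $\{x\mapsto f(sx): s\in S\}$ contains no independent sequence. *)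

(* Defs.v *)
From HB Require Import structures.
From mathcomp Require Import all_boot all_order all_algebra.
From mathcomp Require Import all_classical all_reals all_analysis.

Set Implicit Arguments.
Unset Strict Implicit.
Unset Printing Implicit Defensive.

Import Order.TTheory GRing.Theory Num.Theory.
Import numFieldNormedType.Exports.

Local Open Scope classical_set_scope.
Local Open Scope ring_scope.

Section CircularOrder.
Variables (X : Type) (C : X -> X -> X -> Prop).

Record circular_order : Prop := {
  circ_cyclic : forall a b c, C a b c -> C b c a ;
  circ_asym : forall a b c, C a b c -> ~ C a c b ;
  circ_trans : forall a b c d, C a b c -> C a c d -> C a b d ;
  circ_total : forall a b c, a <> b -> b <> c -> a <> c -> C a b c \/ C a c b
}.

Definition circ_oo (a b : X) : set X := [set x | C a x b].

Definition circ_cc (a b : X) : set X :=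
  [set x | (a = b /\ x = a) \/ (a <> b /\ (C a x b \/ x = a \/ x = b))].

(* Discrete when X has at most two points, as then the intervals circ_oo a b
   are empty and form no base. *)
Definition interval_topology : set (set X) :=
  [set U | ([set: X] #<= `I_2)%card \/
     exists2 I : set (set X),
       (forall A, I A -> exists a b, a <> b /\ A = circ_oo a b) &
       U = \bigcup_(A in I) A].

End CircularOrder.

Definition COP (X1 X2 : Type) (C1 : X1 -> X1 -> X1 -> Prop)
    (C2 : X2 -> X2 -> X2 -> Prop) (f : X1 -> X2) : Prop :=
  (forall a b c, C1 a b c -> f a <> f b -> f b <> f c -> f a <> f c ->
     C2 (f a) (f b) (f c)) /\
  (forall a c, f a = f c ->
     (forall x y, circ_cc C1 a c x -> circ_cc C1 a c y -> f x = f y) \/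
     (forall x y, circ_cc C1 c a x -> circ_cc C1 c a y -> f x = f y)).

HB.mixin Record Monoid_isTopologicalMonoid S & Topological S & Monoid S := {
  mulg_continuous : continuous (fun p : S * S => (p.1 * p.2)%g)
}.

#[short(type="topologicalMonoidType")]
HB.structure Definition TopologicalMonoid :=
  {S of Topological S & Monoid S & Monoid_isTopologicalMonoid S}.

Section Systems.
Variables (S : topologicalMonoidType) (X : topologicalType) (act : S -> X -> X).

Record compact_system : Prop := {
  csys_compact : compact [set: X] ;
  csys_hausdorff : hausdorff_space X ;
  csys_act1 : forall x, act 1%g x = x ;
  csys_actM : forall s t x, act (s * t)%g x = act s (act t x) ;
  csys_continuous : continuous (fun p : S * X => act p.1 p.2)
}.

Definition circularly_ordered_system : Prop :=
  exists C : X -> X -> X -> Prop,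
    [/\ circular_order C,
        open = interval_topology C &
        forall s, COP C C (act s)].

End Systems.

Definition topological_embedding (X Y : topologicalType) (f : X -> Y) : Prop :=
  injective f /\
  forall U : set X, open U <-> exists2 W : set Y, open W & U = f @^-1` W.

Section Ell1.
Variable R : realType.

Definition ell1_pred : {pred nat -> R} :=
  fun a => `[< cvgn [normed series a] >].

Lemma ell1_submod : submod_closed ell1_pred.
Proof.
split=> [|k a b /asboolP ca /asboolP cb]; apply/asboolP => /=.
  rewrite (_ : [normed series _] = cst 0); first exact: is_cvg_cst.
  by apply/funext => n; rewrite /= /series /= big1// => i _; rewrite normr0.
apply: (@series_le_cvg _ _ (fun n => `|k| * `|a n| + `|b n|)) => [n|n|n|].
- exact: normr_ge0.
- by rewrite addr_ge0 ?mulr_ge0.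
- by rewrite /= (le_trans (ler_normD _ _))// lerD2r normrM.
- have -> : series (fun n => `|k| * `|a n| + `|b n|) =
      (fun n => `|k| * [normed series a] n + [normed series b] n).
    by apply/funext => n; rewrite /= /series /= big_split/= mulr_sumr.
  by apply: is_cvgD => //; exact: is_cvgMr.
Qed.

HB.instance Definition _ := GRing.isSubmodClosed.Build R (nat -> R) ell1_pred
  ell1_submod.

Record ell1 := Ell1 { ell1_val :> nat -> R ; _ : ell1_val \in ell1_pred }.

HB.instance Definition _ := [isSub for ell1_val].
HB.instance Definition _ := [Choice of ell1 by <:].
HB.instance Definition _ := [SubChoice_isSubLmodule of ell1 by <:].

Definition ell1_norm (a : ell1) : R := limn [normed series a].

End Ell1.

Section Banach.
Variables (R : realType) (V : completeNormedModType R).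

(* No linear isomorphism of l1 onto a subspace: T is bounded above and below. *)
Definition Rosenthal : Prop :=
  ~ exists (T : {linear ell1 R -> V}) (c d : R),
      0 < c /\ forall a, c * ell1_norm a <= `|T a| <= d * ell1_norm a.

(* The topological dual; its canonical topology below is the weak-star one. *)
Record dual := Dual {
  dual_val :> {scalar V} ;
  dual_continuous : continuous dual_val
}.

HB.instance Definition _ := gen_eqMixin dual.
HB.instance Definition _ := gen_choiceMixin dual.

Definition dual_eval (phi : dual) : {ptws V -> R} := fun v => phi v.

HB.instance Definition _ := Topological.copy dual (initial_topology dual_eval).

(* Operators of norm at most 1; the canonical topology below is the weak
   operator one. *)
Record Theta := MkTheta {
  Theta_val :> {linear V -> V} ;
  Theta_le1 : forall v, `|Theta_val v| <= `|v|
}.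

HB.instance Definition _ := gen_eqMixin Theta.
HB.instance Definition _ := gen_choiceMixin Theta.

Definition Theta_eval (T : Theta) : {ptws V * dual -> R} := fun p => p.2 (T p.1).

HB.instance Definition _ := Topological.copy Theta (initial_topology Theta_eval).

End Banach.

Section Representations.
Variables (S : topologicalMonoidType) (X : topologicalType) (act : S -> X -> X).
Variable R : realType.

Record representation (V : completeNormedModType R)
    (h : S -> Theta V) (alpha : X -> dual V) : Prop := {
  rep_continuous_h : continuous h ;
  rep_h1 : forall v, h 1%g v = v ;
  rep_hM : forall s t v, h (s * t)%g v = h t (h s v) ;
  (* boundedness of alpha in the dual norm *)
  rep_bounded : exists M : R, forall x v, `|alpha x v| <= M * `|v| ;
  rep_continuous_alpha : continuous alpha ;
  rep_equivariant : forall s x v, alpha (act s x) v = alpha x (h s v)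
}.

Definition Rosenthal_representable : Prop :=
  exists V : completeNormedModType R,
    Rosenthal V /\
    exists (h : S -> Theta V) (alpha : X -> dual V),
      representation h alpha /\ topological_embedding alpha.

End Representations.

Definition independent_seq (R : realType) (X : Type) (f : nat -> X -> R) : Prop :=
  exists a b : R, a < b /\
    forall P M : set nat, finite_set P -> finite_set M -> P `&` M = set0 ->
      (\bigcap_(n in P) (f n @^-1` `]-oo, a[)) `&`
      (\bigcap_(n in M) (f n @^-1` `]b, +oo[)) !=set0.

Definition tame (S : topologicalMonoidType) (X : topologicalType)
    (act : S -> X -> X) (R : realType) : Prop :=
  forall f : X -> R, continuous f ->
    ~ exists F : nat -> X -> R,
        (forall n, exists s : S, F n = (fun x => f (act s x))) /\
        independent_seq F.

(* Main.v *)
Require Import Defs.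
From HB Require Import structures.
From mathcomp Require Import all_boot all_order all_algebra.
From mathcomp Require Import all_classical all_reals all_analysis.
From mathcomp Require Import zify ring lra.

Set Implicit Arguments.
Unset Strict Implicit.
Unset Printing Implicit Defensive.

Import Order.TTheory GRing.Theory Num.Theory.
Import numFieldNormedType.Exports.

Local Open Scope classical_set_scope.
Local Open Scope ring_scope.

(** The representing Banach space consists of the continuous functions that are
    limits of continuous functions of bounded variation for the norm given by
    quadratic variation along finite sequences going once around the circle
    ([bvspace]).  The monoid acts on it by translation and the points of the
    system act by evaluation.

    Quadratic variation is chosen because of one inequality ([cross_le]): if [g]
    has bounded variation and [w] is uniformly small, the increments of [g] and
    [w] are almost orthogonal along every sequence.  Applied to [w] itself it
    shows that translates of [g] depend continuously on the monoid element in
    norm, since they do so uniformly and keep their variation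
    ([transl_continuous]); this gives continuity for the weak operator topology.
    Applied to sums it gives a gliding hump ([hump]): inside an isomorphic copy
    of l1 one picks successive blocks of l1 norm 1, each uniformly so small that
    it is almost orthogonal to the sum of the earlier ones.  The norm of a sum of
    [j] blocks then has order the square root of [j], whereas l1 demands order
    [j].

    Uniformly small blocks exist because functions with few large jumps take few
    shapes.  Cutting the circle at a point makes it a linear order, where a
    function with at most [K] jumps admits a monotone labelling with [K + 1]
    labels, equal labels meaning close values ([jump_label]).  Monotone labels
    can be added, so [n] functions are controlled together by [n * K + 1] labels
    ([common_labels]).  A fourth moment estimate then yields signs for which the
    signed sum of [n] functions is small compared with [n] at one sample point
    per label, hence everywhere ([small_signed_sum]).  Bounded quadratic
    variation bounds the number of jumps.

    The same labels give tameness directly: the translates of a continuous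
    function have a common bound on their jumps, by compactness
    ([continuous_jump_bounded]), and an independent sequence would require
    [2 ^ n] labels.

    Evaluation is an embedding because continuous functions of bounded variation
    separate points ([BV_separation]): take a Urysohn function vanishing at [p],
    its running suprema in the two directions starting from [p], and their
    minimum.

    Everything must be stable under COP maps.  To this end the sequences that go
    once around the circle are defined by duality with circularly monotone
    functions ([admissible]), for which stability under composition is
    immediate; that chains of a cut order are of this kind is
    [chain_admissible]. *)

(** * Circular orders cut at a point *)

Section Cut.
Variables (X : Type) (C : X -> X -> X -> Prop) (HC : circular_order C).

(** The linear order obtained by cutting the circle just before [p], so that [p]
    becomes the least point. *)
Definition cut_le (p x y : X) : Prop := [\/ x = p, x = y | C p x y].

Lemma circ_neq a b c : C a b c -> [/\ a <> b, b <> c & a <> c].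
Proof.
have irr u v : ~ C u v v by move=> h; exact: (circ_asym HC h h).
move=> h; split => e; subst.
- by have := circ_cyclic HC (circ_cyclic HC h); exact: irr.
- exact: irr h.
- by have := circ_cyclic HC h; exact: irr.
Qed.

Lemma cut_le_refl p x : cut_le p x x.
Proof. by constructor 2. Qed.

Lemma cut_le_min p x : cut_le p p x.
Proof. by constructor 1. Qed.

Lemma cut_le_trans p x y z : cut_le p x y -> cut_le p y z -> cut_le p x z.
Proof.
move=> [->|->//|h1]; first by constructor 1.
case=> [e|<-|h2]; [|by constructor 3|].
  by subst; have [] := circ_neq h1.
by constructor 3; exact: circ_trans h1 h2.
Qed.

Lemma cut_le_anti p x y : cut_le p x y -> cut_le p y x -> x = y.
Proof.
move=> [->|//|h1].
  by case=> [->//|->//|h]; have [] := circ_neq h.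
by case=> [e|//|h2]; [subst; have [] := circ_neq h1|have := circ_asym HC h1].
Qed.

Lemma cut_le_total p x y : cut_le p x y \/ cut_le p y x.
Proof.
have [->|xp] := pselect (x = p); first by left; constructor 1.
have [->|yp] := pselect (y = p); first by right; constructor 1.
have [->|xy] := pselect (x = y); first by left; constructor 2.
by have [] := circ_total HC (nesym xp) xy (nesym yp);
  [left|right]; constructor 3.
Qed.

Lemma cut_le_circ p x y z : cut_le p x y -> cut_le p y z ->
  x <> y -> y <> z -> C x y z.
Proof.
move=> [->|//|h1] [e|//|h2] xy yz //; subst => //.
  by have [] := circ_neq h1.
apply: (circ_cyclic HC); apply: (circ_cyclic HC).
apply: (circ_trans HC (circ_cyclic HC h2)).
by apply: (circ_cyclic HC); apply: (circ_cyclic HC).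
Qed.

(** This is what lets a function that is monotone for one cut be recognised as
    circularly monotone, a notion that no longer refers to a cut. *)
Lemma circ_cut_le p a b c : C a b c ->
  [\/ cut_le p a b /\ cut_le p b c, cut_le p b c /\ cut_le p c a |
      cut_le p c a /\ cut_le p a b].
Proof.
move=> h; have [nab nbc nac] := circ_neq h.
have h2 := circ_cyclic HC h; have h3 := circ_cyclic HC h2.
have [ab|ba] := cut_le_total p a b; have [bc|cb] := cut_le_total p b c;
  have [ca|ac] := cut_le_total p c a;
  try by [constructor 1|constructor 2|constructor 3].
- by have := circ_asym HC h (cut_le_circ ac cb nac (nesym nbc)).
- by have := circ_asym HC h2 (cut_le_circ ba ac (nesym nab) nac).
- by have := circ_asym HC h3 (cut_le_circ cb ba (nesym nbc) (nesym nab)).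
- by have := circ_asym HC h (cut_le_circ ac cb nac (nesym nbc)).
Qed.

Lemma circ_cc_left x y : circ_cc C x y x.
Proof.
by have [xy|xy] := pselect (x = y); [left|right; split=> //; right; left].
Qed.

Lemma circ_cc_right x y : circ_cc C x y y.
Proof.
by have [xy|xy] := pselect (x = y); [left|right; split=> //; right; right].
Qed.

Lemma circ_cc_cut_le p x y z : cut_le p x y -> circ_cc C x y z ->
  cut_le p x z /\ cut_le p z y.
Proof.
move=> xy [[<- ->]|[nxy [h|[->|->]]]]; try by split => //; exact: cut_le_refl.
case: xy => [e|//|h1]; first by subst; split; [exact: cut_le_min|constructor 3].
split; constructor 3.
  by apply: (circ_cyclic HC); apply: (circ_cyclic HC);
    exact: (circ_trans HC h (circ_cyclic HC h1)).
apply: (circ_cyclic HC); apply: (circ_trans HC (circ_cyclic HC (circ_cyclic HC h1))).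
exact: (circ_cyclic HC (circ_cyclic HC h)).
Qed.

Lemma cut_le_circ_cc p x y z : cut_le p x z -> cut_le p z y -> circ_cc C x y z.
Proof.
move=> xz zy; have [exz|nxz] := pselect (x = z).
  by rewrite exz; exact: circ_cc_left.
have [ezy|nzy] := pselect (z = y); first by rewrite ezy; exact: circ_cc_right.
have h := cut_le_circ xz zy nxz nzy; right; split; last by left.
by have [] := circ_neq h.
Qed.

Lemma circ_cc_wrap p x y z : cut_le p y x -> x <> y ->
  cut_le p x z \/ cut_le p z y -> circ_cc C x y z.
Proof.
move=> yx nxy.
have [ezx|nzx] := pselect (z = x); first by rewrite ezx => _; exact: circ_cc_left.
have [ezy|nzy] := pselect (z = y); first by rewrite ezy => _; exact: circ_cc_right.
move=> h; right; split=> //; left; case: h => [xz|zy].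
  by have /(circ_cyclic HC) := cut_le_circ yx xz (nesym nxy) (nesym nzx).
have := cut_le_circ zy yx nzy (nesym nxy).
by move=> /(circ_cyclic HC)/(circ_cyclic HC).
Qed.

(** Convexity lets an oscillation bound on a basic neighbourhood be used along
    an arc joining two of its points. *)
Lemma circ_oo_convex c d y z : circ_oo C c d y -> circ_oo C c d z ->
  circ_cc C y z `<=` circ_oo C c d \/ circ_cc C z y `<=` circ_oo C c d.
Proof.
rewrite /circ_oo /=.
have aux y' z' : C c y' d -> C c z' d -> cut_le c y' z' ->
    circ_cc C y' z' `<=` [set x | C c x d].
  move=> hy hz yz x /(circ_cc_cut_le yz) [yx xz].
  have [ed|exz|h] := xz; [|by rewrite exz|exact: circ_trans h hz].
  subst; case: yx => [e|e|h]; last by have [] := circ_neq h.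
    by subst; have [] := circ_neq hy.
  by subst; have [] := circ_neq hy.
move=> hy hz; have [yz|zy] := cut_le_total c y z; [left|right]; exact: aux.
Qed.

End Cut.

(** * Circularly monotone functions *)

Section CyclicMonotone.
Variable R : realType.

(** The circular order that the real line inherits from its linear order. *)
Definition cyc_lt (a b c : R) : Prop :=
  [\/ a < b < c, b < c < a | c < a < b].

Variables (X : Type) (C : X -> X -> X -> Prop).

(** If [f a] and [f c] differ, [f] maps the arc from [a] to [c] into the arc from
    [f a] to [f c], so a constancy arc of [g] pulls back; if they agree, [f]
    provides the constancy arc itself. *)
Lemma COP_comp (f : X -> X) (g : X -> R) : circular_order C ->
  COP C C f -> COP C cyc_lt g -> COP C cyc_lt (g \o f).
Proof.
move=> HC [f1 f2] [g1 g2]; split=> [a b c abc ab bc ac|a c /= gac].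
  by apply: (g1) => //; apply: f1 => // e; [apply: ab|apply: bc|apply: ac];
    rewrite /= e.
have arc a' c' x : f a' <> f c' -> circ_cc C a' c' x ->
    circ_cc C (f a') (f c') (f x).
  move=> nfac [[e]|[nac [h|[->|->]]]].
  - by subst.
  - have [->|n1] := pselect (f x = f a'); first exact: circ_cc_left.
    have [->|n2] := pselect (f x = f c'); first exact: circ_cc_right.
    by right; split=> //; left; apply: f1 => //; exact: nesym.
  - exact: circ_cc_left.
  - exact: circ_cc_right.
have [fac|nfac] := pselect (f a = f c).
  have [h|h] := f2 _ _ fac; [left|right] => x y hx hy /=; by rewrite (h x y).
have nfca := nesym nfac.
have [h|h] := g2 _ _ gac; [left|right] => x y hx hy /=;
  by apply: h; exact: arc.
Qed.

Hypothesis HC : circular_order C.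

Lemma cut_nondecreasing_COP p (g : X -> R) :
  (forall x y, cut_le C p x y -> g x <= g y) -> COP C cyc_lt g.
Proof.
move=> mg; split=> [a b c abc ab bc ac|a c gac].
  have ltg x y : cut_le C p x y -> g x <> g y -> g x < g y.
    by move=> /mg; rewrite lt_neqAle => -> /eqP ->.
  have [[h1 h2]|[h1 h2]|[h1 h2]] := circ_cut_le HC p abc.
  - by constructor 1; rewrite !ltg.
  - by constructor 2; rewrite !ltg//; exact: nesym.
  - by constructor 3; rewrite !ltg//; exact: nesym.
have arc a' c' : cut_le C p a' c' -> g a' = g c' ->
    forall x y, circ_cc C a' c' x -> circ_cc C a' c' y -> g x = g y.
  move=> ac gac' x y.
  have cst z : circ_cc C a' c' z -> g z = g a'.
    move=> /(circ_cc_cut_le HC ac)[az zc]; apply/le_anti.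
    by rewrite {1}gac' !mg.
  by move=> /cst -> /cst ->.
by have [h|h] := cut_le_total HC p a c; [left|right]; exact: arc.
Qed.

(** Two descents along a chain would produce a negatively oriented triple of
    values, or a level set that separates two other values on both sides. *)
Lemma COP_no_two_descents p (h : X -> R) y y' z z' : COP C cyc_lt h ->
  cut_le C p y y' -> cut_le C p y' z -> cut_le C p z z' ->
  h y' < h y -> h z' < h z -> False.
Proof.
move=> [h1 h2] yy' y'z zz' dy dz.
have ny : y <> y' by move=> e; rewrite e ltxx in dy.
have nz : z <> z' by move=> e; rewrite e ltxx in dz.
have yz := cut_le_trans HC yy' y'z.
have y'z' := cut_le_trans HC y'z zz'.
have nyz : y <> z by move=> e; subst; exact: ny (cut_le_anti HC yy' y'z).
have ny'z' : y' <> z' by move=> e; subst; exact: nz (esym (cut_le_anti HC y'z zz')).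
have C1 : C y z z' by exact: (cut_le_circ HC yz zz').
have lezy : h z <= h y.
  have [<-|ny'z] := pselect (y' = z); first exact: ltW.
  rewrite leNgt; apply/negP => lt1.
  have C2 : C y y' z by exact: (cut_le_circ HC yy' y'z).
  have n1 : h y <> h y' by move=> e; rewrite e ltxx in dy.
  have n2 : h y' <> h z.
    by move=> e; have := lt_trans dy lt1; rewrite e ltxx.
  have n3 : h y <> h z by move=> e; rewrite e ltxx in lt1.
  by case: (h1 _ _ _ C2 n1 n2 n3) => /andP[]; lra.
have eyz : h y = h z.
  apply/eqP/negPn/negP => /eqP nh.
  have n1 : h z <> h z' by move=> e; rewrite e ltxx in dz.
  have n2 : h y <> h z' by move=> e; have := lt_le_trans dz lezy; rewrite e ltxx.
  have lt1 : h z < h y by rewrite lt_neqAle lezy andbT; apply/eqP; exact: nesym.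
  by case: (h1 _ _ _ C1 nh n1 n2) => /andP[]; lra.
have [k|k] := h2 _ _ eyz.
  have := k _ _ (circ_cc_left C y z) (cut_le_circ_cc HC yy' y'z).
  by move=> e; rewrite e ltxx in dy.
have iz' : circ_cc C z y z'.
  by apply: (circ_cc_wrap HC yz (nesym nyz)); left.
by have := k _ _ (circ_cc_left C z y) iz'; move=> e; rewrite e ltxx in dz.
Qed.

End CyclicMonotone.

(** * Admissible sequences and variation *)

Section Variation.
Variables (R : realType) (X : Type).

(** The increment of index 0 is the value itself, so that variations control the
    supremum of [f] as well. *)
Definition inc (f : X -> R) (x : nat -> X) (i : nat) : R :=
  f (x i) - (if i is j.+1 then f (x j) else 0).

Definition var1 (f : X -> R) (x : nat -> X) (n : nat) : R :=
  \sum_(i < n) `|inc f x i|.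

Definition var2 (f : X -> R) (x : nat -> X) (n : nat) : R :=
  \sum_(i < n) inc f x i ^+ 2.

Variables (C : X -> X -> X -> Prop).

(** The sequences that go around the circle once, described by duality: those
    along which circularly monotone functions into the unit interval have
    variation at most 3.  Since circularly monotone functions can be composed
    with COP maps, COP maps preserve admissibility, even when they collapse arcs
    and the image of a chain is no longer a chain. *)
Definition admissible (x : nat -> X) (n : nat) : Prop :=
  forall g : X -> R, COP C (@cyc_lt R) g -> (forall z, 0 <= g z <= 1) ->
    var1 g x n <= 3.

Definition BV (f : X -> R) : Prop :=
  exists M : R, forall x n, admissible x n -> var1 f x n <= M.

Definition chain (p : X) (x : nat -> X) (n : nat) : Prop :=
  forall i j, (i <= j < n)%N -> cut_le C p (x i) (x j).

Lemma admissible1 (x : nat -> X) : admissible x 1.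
Proof.
move=> g _ g01; rewrite /var1 big_ord1 /inc subr0.
by have /andP[g0 g1] := g01 (x 0%N); rewrite ger0_norm//; lra.
Qed.

Hypothesis HC : circular_order C.

Lemma admissible_COP (s : X -> X) x n : COP C C s -> admissible x n ->
  admissible (s \o x) n.
Proof.
move=> cs ax g cg g01.
exact: (ax (g \o s) (COP_comp HC cs cg) (fun z => g01 (s z))).
Qed.

(** Only one descent is possible along a chain: the values rise to at most 1,
    fall once, and rise again, after a first increment equal to the first
    value. *)
Lemma chain_admissible p x n : chain p x n -> admissible x n.
Proof.
move=> cx g cg g01.
have [->|n0] := posnP n; first by rewrite /var1 big_ord0.
(* Before the descent the variation is at most the current value; at the descent
   it grows by at most 2 more than the value does. *)
suff H k : (k < n)%N -> var1 g x k.+1 <= g (x k) \/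
    (var1 g x k.+1 <= 2 + g (x k) /\
     forall i j, (k <= i)%N -> (i <= j < n)%N -> g (x i) <= g (x j)).
  have := H n.-1; rewrite prednK// => /(_ (leqnn n)).
  by have /andP[] := g01 (x n.-1); move=> ? ? [?|[? _]]; lra.
elim: k => [_|k IH kn].
  left; rewrite /var1 big_ord1 /inc subr0 ger0_norm//.
  by have /andP[] := g01 (x 0%N).
have -> : var1 g x k.+2 = var1 g x k.+1 + `|g (x k.+1) - g (x k)|.
  by rewrite /var1 big_ord_recr.
have := IH (ltnW kn).
have /andP[gk0 gk1] := g01 (x k); have /andP[gk0' gk1'] := g01 (x k.+1).
have [le1|lt1] := leP (g (x k)) (g (x k.+1)).
  rewrite ger0_norm ?subr_ge0// => -[?|[? m]]; first by left; lra.
  right; split; first lra.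
  by move=> i j ki; apply: m; lia.
rewrite ltr0_norm ?subr_lt0// opprB => -[leS|[? m]].
  right; split; first lra.
  move=> i j ki ij; rewrite leNgt; apply/negP => d2.
  by apply: (@COP_no_two_descents R X C HC p g (x k) (x k.+1) (x i) (x j)) => //;
    apply: cx; lia.
have := m k k.+1 (leqnn _); rewrite leqnSn /= => /(_ kn).
by rewrite leNgt lt1.
Qed.

End Variation.

(** * Quadratic variation and its seminorm *)

Section SumSquares.
Variables (R : realType) (n : nat).
Implicit Types u v : 'I_n -> R.

Lemma sum_cauchy_schwarz u v :
  (\sum_i u i * v i) ^+ 2 <= (\sum_i u i ^+ 2) * (\sum_i v i ^+ 2).
Proof.
set A := \sum_i u i ^+ 2; set B := \sum_i v i ^+ 2; set D := \sum_i u i * v i.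
have B0 : 0 <= B by apply: sumr_ge0 => i _; exact: sqr_ge0.
have H : 0 <= B * (A * B - D ^+ 2).
  have -> : B * (A * B - D ^+ 2) = \sum_i (B * u i - D * v i) ^+ 2.
    have -> : \sum_i (B * u i - D * v i) ^+ 2 =
        \sum_i (B ^+ 2 * u i ^+ 2 - (2 * B * D) * (u i * v i) + D ^+ 2 * v i ^+ 2).
      by apply: eq_bigr => i _; ring.
    by rewrite big_split/= sumrB -!mulr_sumr -/A -/B -/D; ring.
  by apply: sumr_ge0 => i _; exact: sqr_ge0.
have [B00|Bn0] := eqVneq B 0.
  have v0 i : v i = 0.
    have /allP : all (fun i => v i ^+ 2 == 0) (index_enum 'I_n).
      have := B00; rewrite /B => /eqP; rewrite psumr_eq0// => i0 _; exact: sqr_ge0.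
    by move=> /(_ i (mem_index_enum i)); rewrite sqrf_eq0 => /eqP.
  by rewrite B00 mulr0 /D big1 ?expr0n// => i _; rewrite v0 mulr0.
have Bp : 0 < B by rewrite lt_neqAle eq_sym Bn0.
by move: H; rewrite pmulr_rge0// subr_ge0.
Qed.

Lemma sum_mul_le u v (a b : R) : 0 <= a -> 0 <= b ->
  \sum_i u i ^+ 2 <= a ^+ 2 -> \sum_i v i ^+ 2 <= b ^+ 2 ->
  \sum_i u i * v i <= a * b.
Proof.
move=> a0 b0 ua vb; apply: le_trans (ler_norm _) _.
rewrite -[X in X <= _]ger0_norm// -[X in _ <= X]ger0_norm ?mulr_ge0//.
rewrite -ler_sqr ?nnegrE// !real_normK ?num_real//.
rewrite (le_trans (sum_cauchy_schwarz u v))// exprMn.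
by apply: ler_pM => //; apply: sumr_ge0 => i _; exact: sqr_ge0.
Qed.

End SumSquares.

Section VariationTheory.
Variables (R : realType) (X : Type).
Implicit Types (f g : X -> R) (x : nat -> X).

Lemma incD f g x i : inc (f + g) x i = inc f x i + inc g x i.
Proof. by case: i => [|i]; rewrite /inc !fctE; ring. Qed.

Lemma incZ (k : R) f x i : inc (k *: f) x i = k * inc f x i.
Proof. by case: i => [|i]; rewrite /inc !fctE /GRing.scale /=; ring. Qed.

Lemma incB f g x i : inc (f - g) x i = inc f x i - inc g x i.
Proof. by case: i => [|i]; rewrite /inc !fctE; ring. Qed.

Lemma inc0 x i : inc (0 : X -> R) x i = 0.
Proof. by case: i => [|i]; exact: (subr0 (0 : R)). Qed.

Lemma inc_le f x i (M : R) : (forall z, `|f z| <= M) -> `|inc f x i| <= 2 * M.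
Proof.
move=> fM; have fx := fM (x i); have M0 := le_trans (normr_ge0 _) fx.
case: i fx => [|i] fx; rewrite /inc /=; first by rewrite subr0; lra.
by rewrite (le_trans (ler_normB _ _))//; have := fM (x i); lra.
Qed.

Lemma var1_ge0 f x n : 0 <= var1 f x n.
Proof. by apply: sumr_ge0. Qed.

Lemma var1D f g x n : var1 (f + g) x n <= var1 f x n + var1 g x n.
Proof. by rewrite -big_split; apply: ler_sum => i _; rewrite incD ler_normD. Qed.

Lemma var1B f g x n : var1 (f - g) x n <= var1 f x n + var1 g x n.
Proof. by rewrite -big_split; apply: ler_sum => i _; rewrite incB ler_normB. Qed.

Lemma var1Z (k : R) f x n : var1 (k *: f) x n = `|k| * var1 f x n.
Proof. by rewrite mulr_sumr; apply: eq_bigr => i _; rewrite incZ normrM. Qed.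

Lemma var2_ge0 f x n : 0 <= var2 f x n.
Proof. by apply: sumr_ge0 => i _; exact: sqr_ge0. Qed.

Lemma var2Z (k : R) f x n : var2 (k *: f) x n = k ^+ 2 * var2 f x n.
Proof. by rewrite mulr_sumr; apply: eq_bigr => i _; rewrite incZ exprMn. Qed.

Lemma var2D f g x n : var2 (f + g) x n =
  var2 f x n + 2 * (\sum_(i < n) inc f x i * inc g x i) + var2 g x n.
Proof.
rewrite mulr_sumr /var2 -!big_split /=.
by apply: eq_bigr => i _; rewrite incD; ring.
Qed.

(** The inequality behind the whole construction: a function of bounded
    variation is almost orthogonal to a uniformly small one. *)
Lemma cross_le f g x n (e : R) : (forall z, `|g z| <= e) ->
  \sum_(i < n) inc f x i * inc g x i <= var1 f x n * (2 * e).
Proof.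
move=> ge; rewrite mulr_suml; apply: ler_sum => i _.
rewrite (le_trans (ler_norm _))// normrM ler_wpM2l//.
exact: inc_le.
Qed.

Lemma var2_le_var1 f x n (e : R) : (forall z, `|f z| <= e) ->
  var2 f x n <= var1 f x n * (2 * e).
Proof.
move=> fe; apply: le_trans _ (cross_le f x n fe).
by under [leRHS]eq_bigr do rewrite -expr2.
Qed.

Variable C : X -> X -> X -> Prop.
Notation admissible := (@admissible R X C).

Definition var2_bounded f (M : R) : Prop :=
  0 <= M /\ forall x n, admissible x n -> var2 f x n <= M ^+ 2.

Lemma var2_bounded0 : var2_bounded 0 0.
Proof.
split=> // x n _; rewrite /var2 big1 ?expr0n// => i _.
by rewrite inc0 expr0n.
Qed.

Lemma var2_boundedD f g a b : var2_bounded f a -> var2_bounded g b ->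
  var2_bounded (f + g) (a + b).
Proof.
move=> [a0 fa] [b0 gb]; split=> [|x n ax]; first exact: addr_ge0.
have ha := fa _ _ ax; have hb := gb _ _ ax.
by have := sum_mul_le a0 b0 ha hb; rewrite var2D sqrrD -mulr_natr; lra.
Qed.

Lemma var2_boundedZ (k : R) f a : var2_bounded f a -> var2_bounded (k *: f) (`|k| * a).
Proof.
move=> [a0 fa]; split=> [|x n ax]; first exact: mulr_ge0.
by rewrite var2Z exprMn real_normK ?num_real// ler_wpM2l ?sqr_ge0// fa.
Qed.

Lemma var2_boundedN f a : var2_bounded f a -> var2_bounded (- f) a.
Proof. by move=> /(var2_boundedZ (-1)); rewrite scaleN1r normrN1 mul1r. Qed.

Lemma var2_boundedB f g a b : var2_bounded f a -> var2_bounded g b ->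
  var2_bounded (f - g) (a + b).
Proof. by move=> fa /var2_boundedN; exact: var2_boundedD. Qed.

Lemma var2_bounded_le f a b : a <= b -> var2_bounded f a -> var2_bounded f b.
Proof.
move=> ab [a0 fa]; have b0 := le_trans a0 ab; split=> // x n /fa h.
by rewrite (le_trans h)// ler_sqr ?nnegrE.
Qed.

Lemma var2_bounded_sup f a z : var2_bounded f a -> `|f z| <= a.
Proof.
move=> [a0 /(_ (fun=> z) 1%N (admissible1 _))].
rewrite /var2 big_ord1 /inc subr0 -(real_normK (num_real _)).
by rewrite ler_sqr ?nnegrE.
Qed.

Lemma BVD f g : BV C f -> BV C g -> BV C (f + g).
Proof.
move=> [a fa] [b gb]; exists (a + b) => x n ax.
by rewrite (le_trans (var1D _ _ _ _))// lerD ?fa ?gb.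
Qed.

Lemma BVZ (k : R) f : BV C f -> BV C (k *: f).
Proof.
move=> [a fa]; exists (`|k| * a) => x n ax.
by rewrite var1Z ler_wpM2l ?fa.
Qed.

Lemma BV_var2_bounded f : BV C f -> exists M, var2_bounded f M.
Proof.
move=> [M fM]; exists (2 * `|M|); split; first by rewrite mulr_ge0.
have fz z : `|f z| <= `|M|.
  have := fM _ _ (admissible1 (fun=> z)); rewrite /var1 big_ord1 /inc subr0.
  by move=> /le_trans; apply; exact: ler_norm.
move=> x n ax; rewrite (le_trans (var2_le_var1 x n fz))//.
have := le_trans (fM _ _ ax) (ler_norm M).
have := var1_ge0 f x n; have := normr_ge0 M; nra.
Qed.

(** The infimum of the bounds is meaningful on the empty space too, where a
    supremum over sequences would range over nothing. *)
Definition var2_norm f : R := inf [set M | var2_bounded f M].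

Lemma var2_norm_var2_bounded f : (exists M, var2_bounded f M) ->
  var2_bounded f (var2_norm f).
Proof.
move=> [M fM].
have n0 : [set M | var2_bounded f M] !=set0 by exists M.
have N0 : 0 <= var2_norm f by apply: lb_le_inf => // a [].
split=> // x n ax; rewrite -(sqr_sqrtr (var2_ge0 f x n)).
rewrite ler_sqr ?nnegrE ?sqrtr_ge0//; apply: lb_le_inf => // a [a0 /(_ _ _ ax)].
by move=> /ler_wsqrtr; rewrite sqrtr_sqr ger0_norm.
Qed.

Lemma var2_norm_le f a : var2_bounded f a -> var2_norm f <= a.
Proof. by move=> fa; apply: ge_inf => //; exists 0 => ? []. Qed.

End VariationTheory.

(** * The Banach space of continuous functions approximable by bounded variation *)

Section Space.
Variables (R : realType) (X : topologicalType) (C : X -> X -> X -> Prop).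

(** Quadratic variation alone would give too large a space; it is the
    approximation by functions of bounded variation that excludes copies of
    l1. *)
Definition bv_approx (f : X -> R) : Prop := continuous f /\
  forall e : R, 0 < e ->
    exists g, [/\ continuous g, BV C g & var2_bounded C (f - g) e].

Definition bvspace_pred : {pred X -> R} := fun f => `[< bv_approx f >].

Lemma bvspace_submod : submod_closed bvspace_pred.
Proof.
split=> [|k f g /asboolP [cf fe] /asboolP [cg ge]]; apply/asboolP.
  split=> [|e e0]; first by move=> x; exact: cvg_cst.
  exists 0; split; first by move=> x; exact: cvg_cst.
    exists 0 => x n _; rewrite /var1 big1// => i _.
    by rewrite inc0 normr0.
  by rewrite subr0; apply: var2_bounded_le (ltW e0) (var2_bounded0 _ _).
have cZ (h : X -> R) : continuous h -> continuous (k *: h).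
  by move=> ch x; apply: cvgZr; exact: ch.
split=> [x|e e0]; first by apply: cvgD; [exact: cZ|exact: cg].
have k1 : 0 < `|k| + 1 by rewrite ltr_wpDl.
have [f' [cf' bf' hf']] := fe (e / 2 / (`|k| + 1)) ltac:(by rewrite !divr_gt0).
have [g' [cg' bg' hg']] := ge (e / 2) ltac:(by rewrite divr_gt0).
exists (k *: f' + g'); split.
- by move=> x; apply: cvgD; [exact: cZ|exact: cg'].
- by apply: BVD => //; exact: BVZ.
- have -> : k *: f + g - (k *: f' + g') = k *: (f - f') + (g - g').
    by rewrite scalerBr opprD addrACA.
  apply: var2_bounded_le (var2_boundedD (var2_boundedZ k hf') hg').
  have : `|k| * (e / 2 / (`|k| + 1)) <= e / 2.
    by rewrite mulrA ler_pdivrMr// mulrDr mulr1 [leLHS]mulrC lerDl divr_ge0// ltW.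
  by lra.
Qed.

HB.instance Definition _ := GRing.isSubmodClosed.Build R (X -> R) bvspace_pred
  bvspace_submod.

Record bvspace := BVSpace {
  bvspace_val :> X -> R ; _ : bvspace_val \in bvspace_pred }.

HB.instance Definition _ := [isSub for bvspace_val].
HB.instance Definition _ := [Choice of bvspace by <:].
HB.instance Definition _ := [SubChoice_isSubLmodule of bvspace by <:].

Implicit Types v w : bvspace.

Lemma bvspace_bv_approx v : bv_approx v.
Proof. by case: v => f /= /asboolP. Qed.

Lemma bvspace_var2_bounded v : var2_bounded C v (var2_norm C v).
Proof.
apply: var2_norm_var2_bounded; have [_ /(_ 1 ltr01)] := bvspace_bv_approx v.
move=> [g [_ /BV_var2_bounded [M gM] vg]]; exists (1 + M).
by rewrite -(subrK g (v : X -> R)); exact: var2_boundedD.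
Qed.

Let var2_normD v w : var2_norm C (v + w) <= var2_norm C v + var2_norm C w.
Proof. by apply: var2_norm_le; apply: var2_boundedD; exact: bvspace_var2_bounded. Qed.

Let var2_normZ (k : R) v : var2_norm C (k *: v) = `|k| * var2_norm C v.
Proof.
have aux (l : R) w : var2_norm C (l *: w) <= `|l| * var2_norm C w.
  by apply: var2_norm_le; apply: var2_boundedZ; exact: bvspace_var2_bounded.
apply/le_anti; rewrite aux /=.
have [->|k0] := eqVneq k 0.
  by rewrite normr0 mul0r; have [] := bvspace_var2_bounded (0 *: v).
have := aux k^-1 (k *: v); rewrite scalerA mulVf// scale1r.
by rewrite -(ler_pM2l (x := `|k|)) ?normr_gt0// mulrA -normrM divff// normr1 mul1r.
Qed.

Let var2_norm_eq0 v : var2_norm C v = 0 -> v = 0.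
Proof.
move=> v0; apply/val_inj/funext => x /=.
by have := var2_bounded_sup x (bvspace_var2_bounded v); rewrite v0 normr_le0 => /eqP.
Qed.

HB.instance Definition _ :=
  Lmodule_isNormed.Build R bvspace var2_normD var2_normZ var2_norm_eq0.

Lemma bvspace_normP v : var2_bounded C v `|v|.
Proof. exact: bvspace_var2_bounded. Qed.

Lemma bvspace_norm_le v (a : R) : var2_bounded C v a -> `|v| <= a.
Proof. exact: var2_norm_le. Qed.

Lemma bvspace_sup v x : `|v x| <= `|v|.
Proof. exact: var2_bounded_sup (bvspace_normP v). Qed.

(** A Cauchy filter converges pointwise, and the quadratic variation along one
    sequence is a continuous function of finitely many values, so bounds on it
    pass to the pointwise limit. *)
Lemma bvspace_complete (F : set_system bvspace) :
  ProperFilter F -> cauchy F -> cvg F.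
Proof.
move=> FF /cauchyP Fc.
have cvx x : cvg ((fun v : bvspace => v x) @ F).
  apply: cauchy_cvg; apply: cauchy_exP => e e0.
  have [v0 Fv0] := Fc e e0; exists (v0 x).
  rewrite /nbhs /=; apply: filterS Fv0 => v; rewrite -!ball_normE /=.
  by apply: le_lt_trans; exact: (bvspace_sup (v0 - v) x).
pose l x : R := lim ((fun v : bvspace => v x) @ F).
have key v0 (e : R) : 0 < e -> F (ball v0 e) -> var2_bounded C ((v0 : X -> R) - l) e.
  move=> e0 Fv0; split=> [|x n ax]; first exact: ltW.
  have cv : (fun v : bvspace => var2 ((v0 : X -> R) - v) x n) @ F -->
      var2 ((v0 : X -> R) - l) x n.
    apply: cvg_big => [|i _]; first exact: add_continuous.
    have cB z : (fun v : bvspace => v0 z - v z) @ F --> v0 z - l z.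
      by apply: cvgB; [exact: cvg_cst|exact: cvx].
    rewrite expr2; under eq_cvg do rewrite expr2.
    have ci : (fun v : bvspace => inc ((v0 : X -> R) - v) x i) @ F -->
        inc ((v0 : X -> R) - l) x i.
      case: (nat_of_ord i) => [|j]; rewrite /inc /=.
        by apply: cvgB; [exact: cB|exact: cvg_cst].
      by apply: cvgB; exact: cB.
    exact: cvgM.
  apply: (cvgr_to_le cv); apply: filterS Fv0 => v.
  rewrite -ball_normE /= => ve.
  have [_ /(_ _ _ ax) h] := bvspace_normP (v0 - v).
  by rewrite (le_trans h)// ler_sqr ?nnegrE ?(ltW e0)// ltW.
have ml : l \in bvspace_pred.
  apply/asboolP; split=> [x|e e0].
    apply/cvgrPdist_le => e e0.
    have e3 : 0 < e / 3 by rewrite divr_gt0.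
    have [v0 /(key _ _ e3) h] := Fc _ e3.
    have [cv0 _] := bvspace_bv_approx v0.
    have /cvgrPdist_le/(_ _ e3) := cv0 x.
    apply: filterS => y hy.
    have hx : `|v0 x - l x| <= e / 3 := var2_bounded_sup x h.
    have h' : `|v0 y - l y| <= e / 3 := var2_bounded_sup y h.
    move: hx h' hy; rewrite !ler_norml; lra.
  have e2 : 0 < e / 2 by rewrite divr_gt0.
  have [v0 /(key _ _ e2) h] := Fc _ e2.
  have [_ /(_ _ e2) [g [cg bg vg]]] := bvspace_bv_approx v0.
  exists g; split=> //.
  have -> : l - g = ((v0 : X -> R) - g) - ((v0 : X -> R) - l).
    by rewrite opprB addrC -addrA [RHS]addrC !addrA subrK.
  by rewrite [e](_ : _ = e / 2 + e / 2); [exact: var2_boundedB|lra].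
apply/cvg_ex; exists (BVSpace ml); apply/cvgrPdist_le => e e0.
have e2 : 0 < e / 2 by rewrite divr_gt0.
have [v0 Fv0] := Fc _ e2; have /var2_boundedN := key _ _ e2 Fv0; rewrite opprB => h.
apply: filterS Fv0 => v; rewrite -ball_normE /= => v0v.
rewrite -(subrK v0 (BVSpace ml)) -addrA (le_trans (ler_normD _ _))//.
have := @bvspace_norm_le (BVSpace ml - v0) _ h; lra.
Qed.

HB.instance Definition _ := Uniform_isComplete.Build bvspace bvspace_complete.

End Space.

(** * Few labels: functions with boundedly many jumps *)

Section Labels.
Variables (R : realType) (X : Type) (C : X -> X -> X -> Prop).
Hypothesis HC : circular_order C.

Definition jump_bounded (p : X) (e : R) (K : nat) (f : X -> R) : Prop :=
  forall x k, chain C p x k.+1 ->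
    (forall i, (i < k)%N -> e < `|f (x i.+1) - f (x i)|) -> (k <= K)%N.

(** The label of a point counts the jumps that a chain can make before it.  If two
    points with a common label had values more than [2 * e] apart, the last value
    of a longest chain would be more than [e] away from one of them, and the
    chain could be prolonged. *)
Lemma jump_label p (e : R) K f : jump_bounded p e K f ->
  exists l : X -> nat, [/\ forall x, (l x <= K)%N,
    forall x y, cut_le C p x y -> (l x <= l y)%N &
    forall x y, l x = l y -> `|f x - f y| <= 2 * e].
Proof.
move=> fK.
pose P x k := exists c, [/\ chain C p c k.+1, cut_le C p (c k) x &
  forall i, (i < k)%N -> e < `|f (c i.+1) - f (c i)|].
have PK x k : P x k -> (k <= K)%N by move=> [c [cc _ cj]]; exact: fK cj.
have P0 x : P x 0%N.
  by exists (fun=> x); split=> // [i j _|]; exact: cut_le_refl.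
have /choice[l lP] x : exists k, P x k /\ forall k', P x k' -> (k' <= k)%N.
  have ex : exists k, `[< P x k >] by exists 0%N; apply/asboolP.
  have ub k : `[< P x k >] -> (k <= K)%N by move=> /asboolP; exact: PK.
  case: (ex_maxnP ex ub) => k /asboolP Pk km; exists k; split=> // k' Pk'.
  by apply: km; apply/asboolP.
have lm x y : cut_le C p x y -> (l x <= l y)%N.
  move=> xy; have [[c [cc cx cj]] _] := lP x; apply: (proj2 (lP y)).
  by exists c; split=> //; exact: cut_le_trans cx xy.
exists l; split=> //; first by move=> x; apply: (PK x); have [] := lP x.
have H x y : cut_le C p x y -> l x = l y -> `|f x - f y| <= 2 * e.
  move=> xy exy; rewrite leNgt; apply/negP => jxy.
  have [[c [cc cx cj]] _] := lP x; set k := l x in cc cx cj exy.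
  have [z [cz zy jz]] : exists z, [/\ cut_le C p (c k) z, cut_le C p z y &
      e < `|f z - f (c k)|].
    have [j1|j1] := ltP e `|f x - f (c k)|; first by exists x.
    exists y; split; [exact: cut_le_trans cx xy|exact: cut_le_refl|].
    have := ler_normB (f x - f (c k)) (f y - f (c k)).
    by rewrite (_ : _ - _ - _ = f x - f y); [lra|ring].
  suff : P y k.+1 by move=> /(proj2 (lP y)); rewrite -exy ltnn.
  exists (fun i => if (i <= k)%N then c i else z); split.
  - move=> i j /andP[ij jk].
    have [jk'|jk'] := leqP j k.
      by rewrite (leq_trans ij jk'); apply: cc; rewrite ij ltnS.
    have [ik|ik] := leqP i k; last exact: cut_le_refl.
    apply: (cut_le_trans HC _ cz); apply: cc; lia.
  - by rewrite ltnn.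
  - move=> i; rewrite ltnS => ik; rewrite ik.
    have [ik'|ki] := ltnP i k; first exact: cj.
    by have -> : i = k by apply/eqP; rewrite eqn_leq ik ki.
move=> x y exy; have [xy|yx] := cut_le_total HC p x y; first exact: H.
by rewrite distrC; exact: H.
Qed.

(** Monotone labels can be added up: equal sums force equal summands, so [n]
    functions are controlled simultaneously by about [n * K] labels instead of
    [K ^ n]. *)
Lemma common_labels p (e : R) K n (f : nat -> X -> R) :
  (forall i, jump_bounded p e K (f i)) ->
  exists L : X -> 'I_(n * K).+1, forall x y, L x = L y ->
    forall i, (i < n)%N -> `|f i x - f i y| <= 2 * e.
Proof.
move=> fK.
have /choice[l lP] i := jump_label (fK i).
have sle x : (\sum_(i < n) l i x < (n * K).+1)%N.
  rewrite ltnS; have <- : (\sum_(i < n) K = n * K)%N.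
    by rewrite sum_nat_const card_ord.
  by apply: leq_sum => i _; have [] := lP i.
exists (fun x => Ordinal (sle x)).
have H x y : cut_le C p x y -> (\sum_(i < n) l i x = \sum_(i < n) l i y)%N ->
    forall i, (i < n)%N -> `|f i x - f i y| <= 2 * e.
  move=> xy exy i ni; have [_ mi ei] := lP i; apply: ei.
  apply/eqP; rewrite eqn_leq mi//=.
  move: exy; rewrite (bigD1 (Ordinal ni))//= [RHS](bigD1 (Ordinal ni))//= => exy.
  rewrite -(leq_add2r (\sum_(j < n | j != Ordinal ni) l j y)) -exy leq_add2l.
  by apply: leq_sum => j _; have [_ mj _] := lP j; exact: mj.
move=> x y [exy] i ni; have [xy|yx] := cut_le_total HC p x y; first exact: H.
by rewrite distrC; exact: H.
Qed.

End Labels.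

(** * Choosing signs *)

Section Signs.
Variable R : realType.

(** The expected value of the potential over a random last sign is controlled by
    the potential with a larger [A], so a good sign exists; the quadratic term
    absorbs the second moments met by the fourth powers. *)
Lemma fourth_moment_signs (Y : finType) (u : nat -> Y -> R) (d : R) :
  (forall i y, `|u i y| <= d) -> forall n (A : R), 0 <= A ->
  exists2 s : nat -> R, forall i, `|s i| = 1 &
    \sum_y ((\sum_(i < n) s i * u i y) ^+ 4 +
            A * (\sum_(i < n) s i * u i y) ^+ 2) <=
    #|Y|%:R * (3 * n%:R ^+ 2 * d ^+ 4 + A * n%:R * d ^+ 2).
Proof.
move=> ud; elim=> [|n IH] A A0.
  exists (fun=> 1) => [i|]; first by rewrite normr1.
  rewrite big1 => [|y _]; last by rewrite big_ord0; ring.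
  by rewrite (_ : _ * _ = 0) //; ring.
have A6 : 0 <= A + 6 * d ^+ 2.
  by apply: addr_ge0 => //; apply: mulr_ge0 => //; exact: sqr_ge0.
have [s s1 sP] := IH _ A6.
pose S y := \sum_(i < n) s i * u i y.
pose F (t : R) := \sum_y ((S y + t * u n y) ^+ 4 + A * (S y + t * u n y) ^+ 2).
set B := #|Y|%:R * _ in sP.
pose B' := #|Y|%:R * (3 * n.+1%:R ^+ 2 * d ^+ 4 + A * n.+1%:R * d ^+ 2).
have FF : F 1 + F (-1) <= 2 * B'.
  have pt y : (S y + 1 * u n y) ^+ 4 + A * (S y + 1 * u n y) ^+ 2 +
      ((S y + -1 * u n y) ^+ 4 + A * (S y + -1 * u n y) ^+ 2) <=
      2 * (S y ^+ 4 + (A + 6 * d ^+ 2) * S y ^+ 2) + 2 * (d ^+ 4 + A * d ^+ 2).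
    set a := S y; set b := u n y.
    have b2 : b ^+ 2 <= d ^+ 2.
      by rewrite -(real_normK (num_real b)) lerXn2r ?nnegrE ?(le_trans _ (ud n y)).
    have b4 : b ^+ 4 <= d ^+ 4.
      by rewrite (exprM b 2 2) (exprM d 2 2) lerXn2r ?nnegrE ?sqr_ge0.
    have h1 := ler_wpM2l A0 b2; have h2 := ler_wpM2r (sqr_ge0 a) b2.
    rewrite [leLHS](_ : _ = 2 * a ^+ 4 + 12 * (b ^+ 2 * a ^+ 2) + 2 * b ^+ 4
       + 2 * A * a ^+ 2 + 2 * (A * b ^+ 2)); last by ring.
    rewrite [leRHS](_ : _ = 2 * a ^+ 4 + 12 * (d ^+ 2 * a ^+ 2) + 2 * d ^+ 4
       + 2 * A * a ^+ 2 + 2 * (A * d ^+ 2)); last by ring.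
    lra.
  rewrite /F -big_split /=.
  apply: (@le_trans _ _ (\sum_y (2 * (S y ^+ 4 + (A + 6 * d ^+ 2) * S y ^+ 2) +
    2 * (d ^+ 4 + A * d ^+ 2)))); first by apply: ler_sum => y _; exact: pt.
  rewrite big_split /= -mulr_sumr sumr_const -[_ *+ #|_|]mulr_natl.
  apply: (@le_trans _ _ (2 * B + #|Y|%:R * (2 * (d ^+ 4 + A * d ^+ 2)))).
    by rewrite lerD2r ler_pM2l.
  rewrite /B /B' -natr1; set N := #|Y|%:R; set m := n%:R.
  have N0 : 0 <= N * d ^+ 4 by rewrite mulr_ge0 ?ler0n// (exprM d 2 2) sqr_ge0.
  rewrite -subr_ge0 (_ : _ - _ = 4 * (N * d ^+ 4)); last by ring.
  exact: mulr_ge0.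
have pick (t : R) : `|t| = 1 -> F t <= B' -> exists2 s : nat -> R,
    forall i, `|s i| = 1 &
    \sum_y ((\sum_(i < n.+1) s i * u i y) ^+ 4 +
            A * (\sum_(i < n.+1) s i * u i y) ^+ 2) <= B'.
  move=> t1 Ft; exists (fun i => if (i < n)%N then s i else t).
    by move=> i; case: ifP.
  have E y : \sum_(i < n.+1) (if (i < n)%N then s i else t) * u i y =
      S y + t * u n y.
    rewrite big_ord_recr /= ltnn; congr (_ + _).
    by apply: eq_bigr => i _; rewrite ltn_ord.
  by under eq_bigr do rewrite E.
have [F1|F1] := leP (F 1) B'; first by apply: (pick 1); rewrite ?normr1.
by apply: (pick (-1)); rewrite ?normrN1//; lra.
Qed.

Variables (X : Type) (C : X -> X -> X -> Prop).
Hypothesis HC : circular_order C.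

(** One sample point per common label suffices, so there are about [m * K] of
    them.  Fourth moments are of order [m ^ 2] at each, which for large [m] leaves
    room below [(e * m) ^ 4]; second moments would just fail. *)
Lemma small_signed_sum (p : X) (d e : R) K : 0 < e ->
  exists2 m : nat, (0 < m)%N & forall v : nat -> X -> R,
    (forall i, jump_bounded C p e K (v i)) -> (forall i x, `|v i x| <= d) ->
    exists2 s : nat -> R, forall i, `|s i| = 1 &
      forall x, `|\sum_(i < m) s i * v i x| <= 3 * e * m%:R.
Proof.
move=> e0; have e4 : 0 < e ^+ 4 by rewrite exprn_gt0.
have D0 : 0 <= 3 * d ^+ 4 * K.+1%:R / e ^+ 4.
  by rewrite divr_ge0 ?(ltW e4)// mulr_ge0// mulr_ge0// (exprM d 2 2) sqr_ge0.
pose m := (Num.bound (3 * d ^+ 4 * K.+1%:R / e ^+ 4)).+1.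
have m0 : (0 < m)%N by [].
exists m => // v vK vd.
have mbig : 3 * d ^+ 4 * (m * K).+1%:R <= e ^+ 4 * m%:R ^+ 2.
  have h1 : 3 * d ^+ 4 * K.+1%:R <= e ^+ 4 * m%:R.
    rewrite [leRHS]mulrC -ler_pdivrMr// ltW// (lt_le_trans (archi_boundP D0))//.
    by rewrite ler_nat.
  have h2 : 3 * d ^+ 4 * (m * K).+1%:R <= 3 * d ^+ 4 * K.+1%:R * m%:R.
    rewrite -[leRHS]mulrA -natrM ler_wpM2l//; last by rewrite ler_nat; lia.
    by rewrite mulr_ge0// (exprM d 2 2) sqr_ge0.
  by rewrite (le_trans h2)// expr2 mulrA ler_wpM2r.
have [L LP] := common_labels HC m vK.
have /choice[r rP] (y : 'I_(m * K).+1) : exists x, (exists z, L z = y) -> L x = y.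
  have [[z zy]|n] := pselect (exists z, L z = y); first by exists z.
  by exists p.
have [s s1 sP] := @fourth_moment_signs _ (fun i y => v i (r y)) d
  (fun i y => vd i (r y)) m 0 (lexx 0).
exists s => // x.
pose S y := \sum_(i < m) s i * v i (r y).
have Sy y : `|S y| <= e * m%:R.
  have : S y ^+ 4 <= (e * m%:R) ^+ 4.
    apply: (@le_trans _ _ (\sum_y (S y ^+ 4 + 0 * S y ^+ 2))).
      rewrite (bigD1 y)//= mul0r addr0 lerDl sumr_ge0// => i _.
      by rewrite mul0r addr0 (exprM _ 2 2) sqr_ge0.
    apply: (le_trans sP); rewrite card_ord !mul0r addr0 exprMn.
    rewrite [leLHS](_ : _ = 3 * d ^+ 4 * (m * K).+1%:R * m%:R ^+ 2); last by ring.
    rewrite [leRHS](_ : _ = e ^+ 4 * m%:R ^+ 2 * m%:R ^+ 2); last by ring.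
    by rewrite ler_wpM2r ?sqr_ge0.
  have -> : S y ^+ 4 = `|S y| ^+ 4.
    by rewrite (exprM _ 2 2) (exprM `|_| 2 2) real_normK ?num_real.
  by rewrite ler_pXn2r ?nnegrE// mulr_ge0// ltW.
have Lr : L (r (L x)) = L x by apply: rP; exists x.
have -> : \sum_(i < m) s i * v i x =
    S (L x) + \sum_(i < m) s i * (v i x - v i (r (L x))).
  by rewrite /S -big_split; apply: eq_bigr => i _ /=; ring.
have : `|\sum_(i < m) s i * (v i x - v i (r (L x)))| <= \sum_(i < m) (2 * e).
  rewrite (le_trans (ler_norm_sum _ _ _))//; apply: ler_sum => i _.
  by rewrite normrM s1 mul1r; apply: LP.
rewrite sumr_const card_ord -[_ *+ m]mulr_natr.
have := Sy (L x); have := ler_normD (S (L x))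
  (\sum_(i < m) s i * (v i x - v i (r (L x)))).
lra.
Qed.

End Signs.

(** * No copy of l1 *)

Section NoEll1.
Variables (R : realType) (X : topologicalType) (C : X -> X -> X -> Prop).
Hypothesis HC : circular_order C.
Notation V := (bvspace R C).

(** Every jump contributes at least [e ^ 2] to the quadratic variation. *)
Lemma var2_bounded_jump_bounded (p : X) (e d : R) : 0 < e ->
  exists K, forall f : X -> R, var2_bounded C f d -> jump_bounded C p e K f.
Proof.
move=> e0; have e2 : 0 < e ^+ 2 by rewrite exprn_gt0.
have D0 : 0 <= d ^+ 2 / e ^+ 2 by rewrite divr_ge0 ?sqr_ge0.
exists (Num.bound (d ^+ 2 / e ^+ 2)) => f [_ fd] x k cx cj.
have := fd _ _ (chain_admissible HC cx); rewrite /var2 big_ord_recl /=.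
have : \sum_(i < k) e ^+ 2 <= \sum_(i < k) inc f x (bump 0 i) ^+ 2.
  apply: ler_sum => i _; rewrite /inc /bump /= add1n add0n.
  rewrite -[leRHS](real_normK (num_real _)) ler_sqr ?nnegrE ?(ltW e0)//.
  by apply: ltW; exact: cj.
rewrite sumr_const card_ord -[_ *+ k]mulr_natl => h1 h2.
have h3 : k%:R * e ^+ 2 <= d ^+ 2.
  by apply: le_trans h1 (le_trans _ h2); rewrite lerDr sqr_ge0.
have : k%:R <= d ^+ 2 / e ^+ 2 by rewrite ler_pdivlMr.
by move=> /le_lt_trans/(_ (archi_boundP D0)); rewrite ltr_nat => /ltnW.
Qed.

Lemma bvspace_val_sum n (F : 'I_n -> V) x : (\sum_i F i) x = \sum_i F i x.
Proof. by elim/big_rec2: _ => [//|i a b _ <-]. Qed.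

(** Gliding hump.  A block of the remaining vectors with small supremum is almost
    orthogonal to the part already built, which is close to a function of
    bounded variation; so squared norms add up instead of norms. *)
Lemma hump (p : X) (d : R) (v : nat -> V) : 1 <= d -> (forall i, `|v i| <= d) ->
  forall j : nat, exists k (b : nat -> R), \sum_(i < k) `|b i| = j%:R /\
    `|\sum_(i < k) b i *: v i| ^+ 2 <= j%:R * (d ^+ 2 + 1).
Proof.
move=> d1 vd; have d0 : 0 < d by exact: lt_le_trans d1.
elim=> [|j [k [b [bj Wj]]]].
  by exists 0%N, (fun=> 0); rewrite !big_ord0 normr0 expr0n mul0r.
set W := \sum_(i < k) b i *: v i in Wj.
have [_ /(_ (1 / (4 * d)))] := bvspace_bv_approx W.
have d4 : 0 < 4 * d by rewrite mulr_gt0.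
rewrite divr_gt0// => /(_ isT)[g [_ [M' gM'] Wg]].
(* The two parts of the cross term are made at most 1/4 each, so that twice their
   sum fits into the summand 1 that accompanies [d ^ 2]. *)
pose M : R := `|M'|.
have gM x n : admissible R C x n -> var1 g x n <= M.
  by move=> /gM' h; rewrite (le_trans h)// ler_norm.
have M0 : 0 <= M by exact: normr_ge0.
pose e : R := 1 / (8 * (M + 1)).
have e0 : 0 < e by rewrite divr_gt0// mulr_gt0// ltr_wpDl.
have e3 : 0 < e / 3 by rewrite divr_gt0.
have [K KP] := var2_bounded_jump_bounded p d e3.
have [m m0 mP] := small_signed_sum HC p d K e3.
have [s s1 sP] := mP (fun i => v (k + i)%N)
  (fun i => KP _ (var2_bounded_le (vd _) (bvspace_normP _)))
  (fun i x => le_trans (bvspace_sup _ x) (vd _)).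
have mR : 0 < m%:R :> R by rewrite ltr0n.
pose w : V := \sum_(i < m) (s i / m%:R) *: v (k + i)%N.
have sm i : `|s i / m%:R| = m%:R^-1.
  by rewrite normrM s1 mul1r ger0_norm ?invr_ge0 ?(ltW mR).
have w_sup x : `|w x| <= e.
  have -> : w x = (\sum_(i < m) s i * v (k + i)%N x) / m%:R.
    rewrite bvspace_val_sum mulr_suml; apply: eq_bigr => i _.
    by rewrite mulrAC.
  rewrite normrM (ger0_norm (x := _^-1)) ?invr_ge0 ?(ltW mR)//.
  rewrite ler_pdivrMr// (le_trans (sP x))//.
  by rewrite ler_wpM2r ?(ltW mR)//; lra.
have wd : `|w| <= d.
  rewrite (le_trans (ler_norm_sum _ _ _))//.
  apply: (@le_trans _ _ (\sum_(i < m) m%:R^-1 * d)).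
    by apply: ler_sum => i _; rewrite normrZ sm ler_wpM2l ?invr_ge0 ?(ltW mR).
  rewrite sumr_const card_ord -mulrnAl -[_ *+ m]mulr_natl mulfV ?mul1r//.
  by rewrite gt_eqF.
exists (k + m)%N, (fun i => if (i < k)%N then b i else s (i - k)%N / m%:R).
rewrite !big_split_ord /=.
have E1 i : (k + i < k)%N = false by lia.
split.
  under eq_bigr do rewrite ltn_ord; rewrite bj.
  under eq_bigr do rewrite E1 sm.
  rewrite sumr_const card_ord -[_ *+ m]mulr_natl mulfV ?gt_eqF//.
  by rewrite -natr1.
have -> : \sum_(i < k) (if (i < k)%N then b i else s (i - k)%N / m%:R) *: v i = W.
  by apply: eq_bigr => i _; rewrite ltn_ord.
have -> : \sum_(i < m) (if (k + i < k)%N then b (k + i)%N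
    else s (k + i - k)%N / m%:R) *: v (k + i)%N = w.
  by apply: eq_bigr => i _; rewrite E1 addKn.
set B := j.+1%:R * _.
have B0 : 0 <= B by rewrite mulr_ge0// addr_ge0// sqr_ge0.
suff : `|W + w| <= Num.sqrt B.
  by rewrite -[X in _ -> _ <= X](sqr_sqrtr B0) ler_sqr ?nnegrE ?sqrtr_ge0.
apply: bvspace_norm_le; split=> [|x n ax]; first exact: sqrtr_ge0.
rewrite (sqr_sqrtr B0) (_ : bvspace_val (W + w) = (W : X -> R) + (w : X -> R))//.
rewrite var2D.
have hW : var2 W x n <= j%:R * (d ^+ 2 + 1).
  by have [_ /(_ _ _ ax) h] := bvspace_normP W; exact: le_trans h Wj.
have hw : var2 w x n <= d ^+ 2.
  by have [_ /(_ _ _ ax)] := var2_bounded_le wd (bvspace_normP w).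
have hc1 : \sum_(i < n) inc ((W : X -> R) - g) x i * inc w x i <= 1 / 4.
  have [a0 /(_ _ _ ax) ha] := Wg.
  apply: le_trans (sum_mul_le a0 (ltW d0) ha hw) _.
  by rewrite mulrAC -mulf_div divff ?gt_eqF// mulr1.
have hc2 : \sum_(i < n) inc g x i * inc w x i <= 1 / 4.
  apply: le_trans (cross_le g x n w_sup) _.
  apply: (@le_trans _ _ (M * (2 * e))).
    by rewrite ler_wpM2r ?gM// mulr_ge0// ltW.
  have -> : M * (2 * e) = (M / (M + 1)) / 4.
    by rewrite /e; field; rewrite gt_eqF// ltr_wpDl.
  rewrite ler_pM2r ?invr_gt0//.
  by rewrite ler_pdivrMr ?mul1r ?ltr_wpDl// lerDl.
have -> : \sum_(i < n) inc W x i * inc w x i =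
    \sum_(i < n) inc ((W : X -> R) - g) x i * inc w x i +
    \sum_(i < n) inc g x i * inc w x i.
  by rewrite -big_split; apply: eq_bigr => i _ /=; rewrite incB; ring.
by rewrite /B -natr1 mulrDl mul1r; lra.
Qed.

Section FiniteEll1.
Implicit Types (b : nat -> R) (k : nat).

Definition cut_seq b k : nat -> R := fun i => if (i < k)%N then b i else 0.

Lemma cut_seq_series b k n : (k <= n)%N ->
  [normed series (cut_seq b k)] n = \sum_(i < k) `|b i|.
Proof.
move=> kn; rewrite (_ : _ n = \sum_(0 <= i < n) `|cut_seq b k i|)//.
rewrite (big_cat_nat (n := k))//=.
rewrite [X in _ + X]big1_seq ?addr0 => [|i]; last first.
  rewrite mem_index_iota /cut_seq => /andP[_ /andP[ki _]].
  by rewrite ltnNge ki normr0.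
rewrite big_mkord; apply: eq_bigr => i _.
by rewrite /cut_seq ltn_ord.
Qed.

Lemma cut_seq_cvg b k :
  [normed series (cut_seq b k)] @ \oo --> \sum_(i < k) `|b i|.
Proof.
apply: cvg_near_cst; exists k => // n /= kn; exact: cut_seq_series.
Qed.

Lemma cut_seq_ell1 b k : cut_seq b k \in @ell1_pred R.
Proof. by apply/asboolP/cvg_ex; eexists; exact: cut_seq_cvg. Qed.

Definition ell1_cut b k : ell1 R := Ell1 (cut_seq_ell1 b k).

Lemma ell1_norm_cut b k : ell1_norm (ell1_cut b k) = \sum_(i < k) `|b i|.
Proof. by apply/cvg_lim => //; exact: cut_seq_cvg. Qed.

Definition ell1_unit k : ell1 R := ell1_cut (fun i => (i == k)%:R) k.+1.

Lemma ell1_norm_unit k : ell1_norm (ell1_unit k) = 1.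
Proof.
rewrite ell1_norm_cut big_ord_recr /= eqxx normr1 big1 ?add0r// => i _.
by rewrite ltn_eqF// normr0.
Qed.

Lemma ell1_cutE b k : ell1_cut b k = \sum_(i < k) b i *: ell1_unit i.
Proof.
elim: k => [|k IH]; first by rewrite big_ord0; exact: val_inj.
rewrite big_ord_recr -IH /=; apply/val_inj/funext => i /=.
rewrite [RHS](_ : _ = cut_seq b k i + b k * cut_seq (fun i => (i == k)%:R) k.+1 i)//.
rewrite /cut_seq ltnS; have [ik|ki|->] := ltngtP i k.
- by rewrite mulr0 addr0.
- by rewrite mulr0 addr0.
- by rewrite mulr1 add0r.
Qed.

End FiniteEll1.

(** Along an l1 basis the norms produced by the gliding hump grow linearly, but
    their squares are bounded by a linear function. *)
Lemma bvspace_Rosenthal : Rosenthal V.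
Proof.
move=> [T [c [d [c0 cd]]]].
have Td i : `|T (ell1_unit i)| <= d.
  by have /andP[_] := cd (ell1_unit i); rewrite ell1_norm_unit mulr1.
have cT (b : nat -> R) k : c * \sum_(i < k) `|b i| <=
    `|\sum_(i < k) b i *: T (ell1_unit i)|.
  have /andP[+ _] := cd (ell1_cut b k).
  rewrite ell1_norm_cut ell1_cutE linear_sum.
  by rewrite (eq_bigr (fun i : 'I_k => b i *: T (ell1_unit i))) => // i _;
    exact: linearZ_LR.
have [[p]|nX] := pselect (inhabited X); last first.
  have := cT (fun=> 1) 1%N; rewrite !big_ord1 normr1 mulr1.
  have -> : 1 *: T (ell1_unit 0) = 0 :> V.
    by apply/val_inj/funext => x; case: nX.
  by rewrite normr0 leNgt c0.
pose D := 1 + `|d|.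
have D1 : 1 <= D by rewrite lerDl.
have TD i : `|T (ell1_unit i)| <= D.
  by rewrite (le_trans (Td i))// (le_trans (ler_norm d))// lerDr.
have c2 : 0 < c ^+ 2 by rewrite exprn_gt0.
have B0 : 0 <= (D ^+ 2 + 1) / c ^+ 2.
  by rewrite divr_ge0 ?addr_ge0 ?sqr_ge0 ?(ltW c2).
pose j := (Num.bound ((D ^+ 2 + 1) / c ^+ 2)).+1.
have [k [b [bj bW]]] := hump p D1 TD j.
have j0 : 0 < j%:R :> R by rewrite ltr0n.
have : (c * j%:R) ^+ 2 <= j%:R * (D ^+ 2 + 1).
  apply: le_trans _ bW; rewrite -bj ler_sqr ?nnegrE//.
  by apply: mulr_ge0; [exact: ltW|exact: sumr_ge0].
rewrite (_ : _ ^+ 2 = j%:R * (c ^+ 2 * j%:R)); last by ring.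
rewrite ler_pM2l// [_ * j%:R]mulrC -ler_pdivlMr// leNgt => /negP; apply.
by rewrite (lt_le_trans (archi_boundP B0))// ler_nat.
Qed.

End NoEll1.

(** * Arcs, and the topology they generate *)

Section Arcs.
Variables (R : realType) (X : topologicalType) (C : X -> X -> X -> Prop).
Hypothesis HC : circular_order C.

Lemma var1_cut_nondecreasing p (g : X -> R) x n :
  (forall y z, cut_le C p y z -> g y <= g z) -> (forall z, 0 <= g z <= 1) ->
  admissible R C x n -> var1 g x n <= 3.
Proof. by move=> mg g01; apply => //; exact: (cut_nondecreasing_COP HC mg). Qed.

Let neq_ind (p : X) : X -> R := fun x => (`[< x <> p >])%:R.

Let var1_neq_ind p x n : admissible R C x n -> var1 (neq_ind p) x n <= 3.
Proof.
apply: (@var1_cut_nondecreasing p) => [y z yz|z]; last first.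
  by rewrite /neq_ind; case: asboolP; rewrite ?lexx ler01.
rewrite /neq_ind ler_nat; case: asboolP => // yp; case: asboolP => // /contrapT zp.
by subst; case: yp; exact: (cut_le_anti HC yz (cut_le_min C _ _)).
Qed.

Lemma var1_indic_set1 (p : X) x n : admissible R C x n ->
  var1 (\1_[set p] : X -> R) x n <= 6.
Proof.
move=> ax.
have -> : \1_[set p] = (fun=> 1) - neq_ind p :> (X -> R).
  apply/funext => y; rewrite indicE; transitivity (1 - neq_ind p y) => //.
  rewrite /neq_ind; case: asboolP => [yp|/contrapT ->].
    by rewrite memNset ?subrr.
  by rewrite mem_set// subr0.
apply: (le_trans (var1B _ _ _ _)); have := var1_neq_ind p ax.
have : var1 (fun=> 1 : R) x n <= 3.
  apply: (@var1_cut_nondecreasing p) => // z.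
  by rewrite lexx ler01.
lra.
Qed.

(** Seen from the cut at [c], the arc is the complement of two conditions that are
    monotone: being equal to [c], and lying beyond [d]. *)
Lemma var1_indic_circ_oo (c d : X) x n : c <> d -> admissible R C x n ->
  var1 (\1_(circ_oo C c d) : X -> R) x n <= 6.
Proof.
move=> cd ax; pose g : X -> R := fun y => (`[< cut_le C c d y >])%:R.
have -> : \1_(circ_oo C c d) = neq_ind c - g :> (X -> R).
  apply/funext => y; rewrite indicE; transitivity (neq_ind c y - g y) => //.
  rewrite /neq_ind /g; case: asboolP => [yc|/contrapT ->]; last first.
    case: asboolP => [dc|_].
      by case: cd; apply: (cut_le_anti HC (cut_le_min _ _ _) dc).
    by rewrite memNset ?subrr// => h; have [] := circ_neq HC h.
  case: asboolP => [dy|ndy].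
    rewrite memNset ?subrr// => h; have [_ yd _] := circ_neq HC h.
    by apply: yd; apply: (cut_le_anti HC _ dy); constructor 3.
  have [[//|e|h]|//] := cut_le_total HC c y d.
    by case: ndy; rewrite e; exact: cut_le_refl.
  by rewrite mem_set// subr0.
apply: (le_trans (var1B _ _ _ _)); have := var1_neq_ind c ax.
have : var1 g x n <= 3.
  apply: (@var1_cut_nondecreasing c) => // [y z yz|z]; last first.
    by rewrite /g; case: asboolP; rewrite ?lexx ler01.
  rewrite /g ler_nat; case: asboolP => // dy; case: asboolP => // -[].
  exact: cut_le_trans dy yz.
lra.
Qed.

Hypothesis oC : open = interval_topology C.

(** Basic neighbourhoods are open arcs, or singletons when the space has at most
    two points; stating their common properties once avoids treating the
    discrete case separately later. *)
Lemma arc_nbhs (U : set X) (x : X) : nbhs x U -> exists J : set X,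
  [/\ nbhs x J, J `<=` U,
    forall y z, J y -> J z -> circ_cc C y z `<=` J \/ circ_cc C z y `<=` J &
    forall w n, admissible R C w n -> var1 (\1_J : X -> R) w n <= 6].
Proof.
move=> nU; have [V [oV Vx] VU] : exists2 V, open_nbhs x V & V `<=` U.
  by move: nU; rewrite nbhsE.
have := oV; rewrite oC => -[X2|[I Iab VE]].
  exists [set x]; split.
  - by apply: open_nbhs_nbhs; split=> //; rewrite oC; left.
  - by move=> _ ->; exact: VU.
  - by move=> y z -> ->; left => w [[_ ->]|[]].
  - by move=> w n; exact: var1_indic_set1.
have := Vx; rewrite VE => -[A IA Ax].
have [a [b [ab AE]]] := Iab A IA; subst A.
exists (circ_oo C a b); split.
- apply: open_nbhs_nbhs; split=> //; rewrite oC; right.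
  exists [set circ_oo C a b]; first by move=> _ ->; exists a, b.
  by rewrite bigcup_set1.
- by move=> y hy; apply: VU; rewrite VE; exists (circ_oo C a b).
- by move=> y z; exact: circ_oo_convex.
- by move=> w n; exact: var1_indic_circ_oo.
Qed.

Hypothesis compX : compact [set: X].

Lemma finite_cover_seq (J : X -> set X) : (forall x, nbhs x (J x)) ->
  exists s : seq X, forall y, exists2 x, x \in s & J x y.
Proof.
move=> nJ.
pose F : set_system (seq X) :=
  [set A | exists s0 : seq X, forall s : seq X, {subset s0 <= s} -> A s].
have FF : Filter F.
  split.
  - by exists [::].
  - move=> A B [s As] [t Bt]; exists (s ++ t) => r str; split.
      by apply: As => x xs; apply: str; rewrite mem_cat xs.
    by apply: Bt => x xt; apply: str; rewrite mem_cat xt orbT.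
  - by move=> A B AB [s As]; exists s => r /As; exact: AB.
have /compact_near_coveringP cX := compX.
have [x _|s0 s0P] := cX _ F (fun (s : seq X) y => exists2 x, x \in s & J x y) FF.
  exists (J x, [set s : seq X | x \in s]) => /=.
    by split; [exact: nJ|exists [:: x] => s; apply; rewrite mem_head].
  by move=> [y s] /= [Jy xs]; exists x.
by exists s0 => y; apply: (s0P s0).
Qed.

(** A jump of a continuous function leaves one of finitely many arcs on which it
    hardly oscillates, and each arc can be left only a few times. *)
Lemma continuous_jump_bounded (f : X -> R) (e : R) : continuous f -> 0 < e ->
  exists K, forall x k, admissible R C x k.+1 ->
    (forall i, (i < k)%N -> e < `|f (x i.+1) - f (x i)|) -> (k <= K)%N.
Proof.
move=> cf e0; have e2 : 0 < e / 2 by rewrite divr_gt0.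
have /choice[J JP] (x : X) : exists J : set X, [/\ nbhs x J,
    forall y z, J y -> J z -> `|f y - f z| <= e &
    forall w n, admissible R C w n -> var1 (\1_J : X -> R) w n <= 6].
  have /cvgrPdist_le/(_ _ e2)/arc_nbhs[J [nJ JU _ vJ]] := cf x.
  exists J; split=> // y z /JU /= hy /JU /= hz.
  move: hy hz; rewrite !ler_norml; lra.
have [s sP] := finite_cover_seq (fun x => let: And3 h _ _ := JP x in h).
exists (6 * size s)%N => w k aw jw.
have : \sum_(x <- s) var1 (\1_(J x) : X -> R) w k.+1 <= \sum_(x <- s) 6.
  by apply: ler_sum => x _; have [_ _] := JP x; exact.
rewrite big_const_seq count_predT iter_addr_0 -mulrnA => h.
rewrite -(ler_nat R); apply: le_trans h; rewrite /var1 exchange_big /=.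
rewrite big_ord_recl /=; apply: ler_wpDl.
  by apply: sumr_ge0 => x _.
have -> : k%:R = \sum_(i < k) 1 :> R by rewrite sumr_const card_ord.
apply: ler_sum => i _; have [x xs Jx] := sP (w i).
rewrite (big_rem x)//= ler_wpDr//; first by apply: sumr_ge0 => y _.
have -> : bump 0 i = i.+1 by [].
rewrite /inc /= !indicE (mem_set Jx) memNset ?sub0r ?normrN1// => Jx'.
have [_ /(_ _ _ Jx' Jx) + _] := JP x.
by rewrite leNgt (jw i (ltn_ord i)).
Qed.

(** Running suprema of a Urysohn function along the two arcs that leave [p] are
    monotone, and their minimum is again continuous because it moves, between
    two points, by at most the oscillation over an arc joining them. *)
Lemma BV_separation p q : hausdorff_space X -> p <> q ->
  exists f : X -> R, [/\ continuous f, BV C f & f p <> f q].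
Proof.
move=> hX pq.
have T1 := accessible_closed_set1 (hausdorff_accessible hX).
have sep : uniform_separator [set p] [set q].
  apply: (normal_uniform_separator (compact_normal hX compX)) => //.
  by apply/disjoints_subset => x ->; exact: pq.
pose u : X -> R := Urysohn [set p] [set q].
have cu : continuous u by exact: Urysohn_continuous.
have u01 x : 0 <= u x <= 1.
  by have := @Urysohn_range X R [set p] [set q] (u x); rewrite /= in_itv /=;
    apply; exists x.
have up : u p = 0 by apply: (Urysohn_sub0 sep); exists p.
have uq : u q = 1 by apply: (Urysohn_sub1 sep); exists q.
pose U x := sup [set u y | y in [set y | cut_le C p y x]].
pose D x := sup [set u y | y in [set y | cut_le C p x y]].
have ub (A : set X) y : A y -> u y <= sup [set u y | y in A].
  move=> Ay; apply: ub_le_sup; last by exists y.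
  by exists 1 => _ [z _ <-]; have /andP[] := u01 z.
have lub (A : set X) y b : A y -> (forall z, A z -> u z <= b) ->
    sup [set u y | y in A] <= b.
  move=> Ay Ab; apply: ge_sup; first by exists (u y); exists y.
  by move=> _ [z Az <-]; exact: Ab.
have uU x y : cut_le C p y x -> u y <= U x.
  exact: (ub [set y | cut_le C p y x]).
have uD x y : cut_le C p x y -> u y <= D x.
  exact: (ub [set y | cut_le C p x y]).
have Ule x b : (forall z, cut_le C p z x -> u z <= b) -> U x <= b.
  exact: (lub [set y | cut_le C p y x] x b (cut_le_refl C p x)).
have Dle x b : (forall z, cut_le C p x z -> u z <= b) -> D x <= b.
  exact: (lub [set y | cut_le C p x y] x b (cut_le_refl C p x)).
have U01 x : 0 <= U x <= 1.
  rewrite (le_trans _ (uU x x (cut_le_refl _ _ _))); last by have /andP[] := u01 x.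
  by apply: Ule => z _; have /andP[] := u01 z.
have D01 x : 0 <= D x <= 1.
  rewrite (le_trans _ (uD x x (cut_le_refl _ _ _))); last by have /andP[] := u01 x.
  by apply: Dle => z _; have /andP[] := u01 z.
have mU x y : cut_le C p x y -> U x <= U y.
  by move=> xy; apply: Ule => z zx; apply: uU; exact: cut_le_trans zx xy.
have mD x y : cut_le C p x y -> D y <= D x.
  by move=> xy; apply: Dle => z yz; apply: uD; exact: cut_le_trans xy yz.
pose f x := Num.min (U x) (D x).
have osc x y (e : R) : (forall z w, circ_cc C x y z -> circ_cc C x y w ->
    u z - u w <= e) -> `|f x - f y| <= e.
  move=> ue.
  have cx := circ_cc_left C x y; have cy := circ_cc_right C x y.
  have [xy|nxy] := pselect (cut_le C p x y).
    have h1 := mU _ _ xy; have h2 := mD _ _ xy.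
    have h3 : U y <= U x + e.
      apply: Ule => z zy; have [zx|xz] := cut_le_total HC p z x.
        have := ue _ _ cx cx; have := uU _ _ zx; lra.
      have := ue _ _ (cut_le_circ_cc HC xz zy) cx.
      have := uU x x (cut_le_refl _ _ _); lra.
    have h4 : D x <= D y + e.
      apply: Dle => z xz; have [yz|zy] := cut_le_total HC p y z.
        have := ue _ _ cx cx; have := uD _ _ yz; lra.
      have := ue _ _ (cut_le_circ_cc HC xz zy) cy.
      have := uD y y (cut_le_refl _ _ _); lra.
    by rewrite /f /Num.min ler_norml; do 2 case: ifPn; rewrite -?leNgt => ? ?;
      apply/andP; split; lra.
  have yx : cut_le C p y x by have [] := cut_le_total HC p x y.
  have nexy : x <> y by move=> exy; apply: nxy; rewrite exy; exact: cut_le_refl.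
  (* The arc from [x] to [y] passes through [p], where [u] vanishes. *)
  have cp : circ_cc C x y p.
    by apply: (circ_cc_wrap HC yx nexy); right; exact: cut_le_min.
  have h1 : D x <= e.
    apply: Dle => z xz.
    have := ue _ _ (circ_cc_wrap HC yx nexy (or_introl xz)) cp.
    by rewrite up subr0.
  have h2 : U y <= e.
    apply: Ule => z zy.
    have := ue _ _ (circ_cc_wrap HC yx nexy (or_intror zy)) cp.
    by rewrite up subr0.
  have /andP[? ?] := U01 x; have /andP[? ?] := U01 y.
  have /andP[? ?] := D01 x; have /andP[? ?] := D01 y.
  by rewrite /f /Num.min ler_norml; do 2 case: ifPn; rewrite -?leNgt => ? ?;
      apply/andP; split; lra.
exists f; split.
- move=> x; apply/cvgrPdist_le => e e0; have e2 : 0 < e / 2 by rewrite divr_gt0.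
  have /cvgrPdist_le/(_ _ e2)/arc_nbhs[J [nJ JU Jc _]] := cu x.
  have Ju z w : J z -> J w -> u z - u w <= e.
    by move=> /JU /= + /JU /=; rewrite !ler_norml; lra.
  apply: filterS (nJ) => y Jy /=.
  have [h|h] := Jc x y (nbhs_singleton nJ) Jy.
    by apply: osc => z w /h + /h; exact: Ju.
  by rewrite distrC; apply: osc => z w /h + /h; exact: Ju.
- exists (3 + (3 + 3)) => x n ax.
  have vU : var1 U x n <= 3 by exact: (@var1_cut_nondecreasing p).
  have v1 : var1 (fun=> 1 : R) x n <= 3.
    by apply: (@var1_cut_nondecreasing p) => // z; rewrite lexx ler01.
  have v1D : var1 ((fun=> 1) - D) x n <= 3.
    apply: (@var1_cut_nondecreasing p) => // [y z yz|z].
      by change (1 - D y <= 1 - D z); have := mD _ _ yz; lra.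
    by change (0 <= 1 - D z <= 1); have /andP[? ?] := D01 z; apply/andP; split; lra.
  have vD : var1 D x n <= 3 + 3.
    rewrite -[D](opprK) -[- D](addKr (fun=> 1)) opprD opprK.
    by rewrite (le_trans (var1B _ _ _ _))// lerD.
  apply: (@le_trans _ _ (var1 U x n + var1 D x n)); last exact: lerD.
  rewrite -big_split; apply: ler_sum => i _.
  have mm (a b a' b' : R) : `|Num.min a b - Num.min a' b'| <= `|a - a'| + `|b - b'|.
    have := ler_norm (a - a'); have := ler_norm (b - b').
    have := ler_norm (- (a - a')); have := ler_norm (- (b - b')).
    rewrite !normrN /Num.min ler_norml.
    by do 2 case: ifPn; rewrite -?leNgt => ? ? ? ? ? ?; apply/andP; split; lra.
  case: i => -[|i] _ /=; rewrite /inc /=; last exact: mm.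
  by have := mm (U (x 0%N)) (D (x 0%N)) 0 0; rewrite minxx.
- have : f p <= 0.
    rewrite /f ge_min; apply/orP; left; apply: Ule => z zp.
    by rewrite (cut_le_anti HC zp (cut_le_min _ _ _)) up.
  have : 1 <= f q.
    by rewrite /f le_min -uq uU ?uD//; exact: cut_le_refl.
  lra.
Qed.

End Arcs.

(** * Tameness *)

Section Tame.
Variables (R : realType) (S : topologicalMonoidType) (X : topologicalType).
Variables (act : S -> X -> X) (C : X -> X -> X -> Prop).
Hypotheses (HC : circular_order C) (oC : open = interval_topology C).
Hypotheses (compX : compact [set: X]) (copS : forall s, COP C C (act s)).

(** Independence would give a point for each of the [2 ^ n] choices of signs, with
    pairwise distinct common labels, but there are only about [n * K] labels.
    The bound [K] is uniform over the translates because it is stated for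
    admissible sequences. *)
Lemma circularly_ordered_tame : tame act R.
Proof.
move=> f cf [F [Fs [a [b [ab Find]]]]].
have [[p]|nX] := pselect (inhabited X); last first.
  have [x _] := Find set0 set0 (finite_set0 _) (finite_set0 _) (set0I _).
  by case: nX.
pose e : R := (b - a) / 3; have e0 : 0 < e by rewrite divr_gt0// subr_gt0.
have [K KP] := continuous_jump_bounded HC oC compX cf e0.
have FK n : jump_bounded C p e K (F n).
  move=> x k cx jx; have [s Fn] := Fs n.
  apply: (KP (act s \o x)).
    by apply: (admissible_COP HC (copS s)); exact: (chain_admissible HC cx).
  by move=> i ik; have := jx i ik; rewrite Fn.
pose n := (4 * K + 2)%N.
have [L LP] := common_labels HC n FK.
have /choice[x xP] (A : {set 'I_n}) : exists x,
    (forall i : 'I_n, i \in A -> F i x < a) /\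
    (forall i : 'I_n, i \notin A -> b < F i x).
  pose P := [set k : nat | exists2 i : 'I_n, i \in A & k = i :> nat].
  pose M := [set k : nat | exists2 i : 'I_n, i \notin A & k = i :> nat].
  have fin (Q : set nat) : Q `<=` `I_n -> finite_set Q.
    by move=> h; apply: sub_finite_set h _; exact: finite_II.
  have [|||x [xP xM]] := Find P M.
  - by apply: fin => k [i _ ->] /=.
  - by apply: fin => k [i _ ->] /=.
  - apply/disjoints_subset => k [i iA ->] [j jA] /ord_inj ij.
    by move: jA; rewrite -ij iA.
  exists x; split=> i iA.
    by have := xP i (ex_intro2 _ _ i iA erefl); rewrite /= in_itv.
  by have := xM i (ex_intro2 _ _ i iA erefl); rewrite /= in_itv /= andbT.
have injL : injective (L \o x).
  move=> A B /= LAB; apply/setP => i.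
  have := LP _ _ LAB i (ltn_ord i); have [xa xb] := xP A; have [ya yb] := xP B.
  rewrite ler_norml /e => /andP[h1 h2].
  case: (boolP (i \in A)) => [/xa|/xb] hA;
    case: (boolP (i \in B)) => [/ya|/yb] hB //;
    exfalso; lra.
have := leq_card _ injL.
rewrite -cardsT -powersetT card_powerset cardsT !card_ord leqNgt => /negP; apply.
have h : ((2 * K + 1).+1 <= 2 ^ (2 * K + 1))%N by exact: ltn_expl.
have -> : n = ((2 * K + 1) * 2)%N by rewrite /n; lia.
rewrite expnM; nia.
Qed.

End Tame.

(** * The representation *)

Section Representation.
Variables (R : realType) (S : topologicalMonoidType) (X : topologicalType).
Variables (act : S -> X -> X) (C : X -> X -> X -> Prop).
Hypotheses (hX : compact_system act) (HC : circular_order C).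
Hypotheses (oC : open = interval_topology C) (copS : forall s, COP C C (act s)).
Notation V := (bvspace R C).

Lemma act_continuous s : continuous (act s).
Proof.
move=> x; apply: (@continuous_comp _ _ _ (fun y => (s, y)) (fun p => act p.1 p.2)).
  by apply: cvg_pair; [exact: cvg_cst|exact: cvg_id].
exact: (@csys_continuous _ _ _ hX (s, x)).
Qed.

Lemma var2_bounded_act (f : X -> R) s a : var2_bounded C f a ->
  var2_bounded C (f \o act s) a.
Proof.
by move=> [a0 fa]; split=> // x n ax; exact: (fa _ _ (admissible_COP HC (copS s) ax)).
Qed.

Lemma BV_act (f : X -> R) s : BV C f -> BV C (f \o act s).
Proof.
move=> [M fM]; exists M => x n ax.
exact: (fM _ _ (admissible_COP HC (copS s) ax)).
Qed.

Lemma bv_approx_act (f : X -> R) s : bv_approx C f -> bv_approx C (f \o act s).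
Proof.
move=> [cf fe].
have cont (g : X -> R) : continuous g -> continuous (g \o act s).
  by move=> cg x; apply: continuous_comp; [exact: act_continuous|exact: cg].
split=> [|e /fe[g [cg bg fg]]]; first exact: cont.
exists (g \o act s); split; [exact: cont|exact: BV_act|exact: (var2_bounded_act s fg)].
Qed.

Lemma transl_subproof (v : V) s : (v : X -> R) \o act s \in bvspace_pred C.
Proof. by apply/asboolP/bv_approx_act; exact: bvspace_bv_approx. Qed.

Definition transl (s : S) (v : V) : V := BVSpace (transl_subproof v s).

Lemma transl_linear s : linear (transl s).
Proof. by move=> k v w; exact: val_inj. Qed.

HB.instance Definition _ s :=
  GRing.isLinear.Build R V V _ (transl s) (transl_linear s).

Lemma transl_le s v : `|transl s v| <= `|v|.
Proof. by apply: bvspace_norm_le; apply: var2_bounded_act; exact: bvspace_normP. Qed.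

Definition transl_Theta s : Theta V := MkTheta (transl_le s).

(** Joint continuity of the action and compactness of the space make translation
    continuous for the supremum norm. *)
Lemma sup_continuous (g : X -> R) (e : R) s0 : continuous g -> 0 < e ->
  \forall s \near s0, forall x, `|g (act s0 x) - g (act s x)| <= e.
Proof.
move=> cg e0; have e2 : 0 < e / 2 by rewrite divr_gt0.
have /compact_near_coveringP cX := csys_compact hX.
have near x : [set: X] x ->
    \forall x' \near x & s \near s0, `|g (act s0 x') - g (act s x')| <= e.
  move=> _; have cgx : {for (s0, x), continuous (g \o (fun p => act p.1 p.2))}.
    apply: continuous_comp; last exact: cg.
    exact: (@csys_continuous _ _ _ hX (s0, x)).
  move/cvgrPdist_le: cgx => /(_ _ e2) [[A B] /= [As0 Bx] AB].
  exists (B, A) => //= -[y s] /= [By As].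
  have := AB (s, y) (conj As By); have := AB (s0, y) (conj (nbhs_singleton As0) By).
  by rewrite /= !ler_norml; lra.
have := cX S (nbhs s0) (fun s x => `|g (act s0 x) - g (act s x)| <= e)
  (nbhs_filter s0) near.
by apply: filterS => s h x; exact: h.
Qed.

(** A function of bounded variation moves continuously for the quadratic
    variation norm because its translates have the same variation and are
    uniformly close; contractivity carries this over to limits. *)
Lemma transl_continuous (v : V) : continuous (transl^~ v).
Proof.
move=> s0; apply/cvgrPdist_le => e e0.
have e3 : 0 < e / 3 by rewrite divr_gt0.
have [_ /(_ _ e3) [g [cg bg vg]]] := bvspace_bv_approx v.
have [M' gM'] := bg; pose M : R := `|M'| + 1.
have M0 : 0 < M by rewrite ltr_wpDl.
have gM x n : admissible R C x n -> var1 g x n <= M.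
  by move=> /gM' h; have := ler_norm M'; rewrite /M; lra.
pose eta : R := (e / 3) ^+ 2 / (4 * M).
have eta0 : 0 < eta by rewrite divr_gt0 ?exprn_gt0 ?mulr_gt0.
apply: filterS (sup_continuous s0 cg eta0) => s gs.
apply: bvspace_norm_le.
rewrite (_ : bvspace_val _ = (((v : X -> R) - g) \o act s0) -
    (((v : X -> R) - g) \o act s) + ((g \o act s0) - (g \o act s))); last first.
  apply/funext => x.
  change (v (act s0 x) - v (act s x) = (v (act s0 x) - g (act s0 x)) -
   (v (act s x) - g (act s x)) + (g (act s0 x) - g (act s x))); ring.
rewrite (_ : e = e / 3 + e / 3 + e / 3); last by lra.
apply: var2_boundedD; first by apply: var2_boundedB; exact: var2_bounded_act.
split=> [|x n ax]; first exact: ltW.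
apply: le_trans (var2_le_var1 x n gs) _.
have h : var1 ((g \o act s0) - (g \o act s)) x n <= 2 * M.
  rewrite (le_trans (var1B _ _ _ _))// mulr2n mulrDl mul1r.
  by apply: lerD; apply: gM; exact: (admissible_COP HC (copS _) ax).
apply: (@le_trans _ _ (2 * M * (2 * eta))).
  by rewrite ler_wpM2r// mulr_ge0// ltW.
rewrite [leLHS](_ : _ = (e / 3) ^+ 2)// /eta.
by field; rewrite gt_eqF.
Qed.

Definition eval (x : X) (v : V) : R := v x.

Lemma eval_scalar x : scalar (eval x).
Proof. by []. Qed.

HB.instance Definition _ x := GRing.isLinear.Build R V R _ (eval x) (eval_scalar x).

Lemma eval_continuous x : continuous (eval x).
Proof.
move=> v; apply/(@cvgrPdist_le _ _ _ _ (nbhs_filter v)) => e e0.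
apply: filterS (nbhsx_ballx v e e0) => w; rewrite -ball_normE /= => /ltW.
by apply: le_trans; exact: (bvspace_sup (v - w) x).
Qed.

Definition eval_dual (x : X) : dual V := Dual (eval_continuous (x := x)).

Lemma eval_dual_ptws_continuous : continuous (@dual_eval R V \o eval_dual).
Proof.
move=> x; apply/pointwise_cvgP => v.
by have [cv _] := bvspace_bv_approx v; exact: cv.
Qed.

Lemma eval_dual_continuous : continuous eval_dual.
Proof. exact: (continuous_comp_initial eval_dual_ptws_continuous). Qed.

Lemma transl_representation : representation act transl_Theta eval_dual.
Proof.
split.
- apply: continuous_comp_initial => s; apply/pointwise_cvgP => -[v phi] /=.
  apply: (@continuous_comp _ _ _ (transl^~ v) phi); first exact: transl_continuous.
  exact: dual_continuous.
- move=> v; apply/val_inj/funext => x /=; congr (v _).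
  exact: (csys_act1 hX).
- move=> s t v; apply/val_inj/funext => x /=; congr (v _).
  exact: (csys_actM hX).
- by exists 1 => x v; rewrite mul1r; exact: bvspace_sup.
- exact: eval_dual_continuous.
- by [].
Qed.

Lemma BV_bv_approx (f : X -> R) : continuous f -> BV C f -> bv_approx C f.
Proof.
move=> cf bf; split=> // e e0; exists f; split=> //.
by rewrite subrr; apply: var2_bounded_le (ltW e0) (var2_bounded0 _ _).
Qed.

Lemma eval_dual_ptws_injective : injective (@dual_eval R V \o eval_dual).
Proof.
move=> x y exy; apply: contrapT => nxy.
have [f [cf bf fxy]] :=
  BV_separation R HC oC (csys_compact hX) (csys_hausdorff hX) nxy.
have mf : f \in bvspace_pred C by apply/asboolP; exact: BV_bv_approx.
exact: fxy (congr1 (fun phi => phi (BVSpace mf)) exy).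
Qed.

(** Compactness of the space turns the injective continuous map into the
    Hausdorff product of lines into an embedding; the weak-star topology is the
    one induced from that product. *)
Lemma eval_dual_embedding : topological_embedding eval_dual.
Proof.
split=> [x y exy|U]; first by apply: eval_dual_ptws_injective; rewrite /= exy.
split=> [oU|[W oW ->]]; last first.
  by apply: open_comp => // x _; exact: eval_dual_continuous.
pose beta : X -> {ptws V -> R} := @dual_eval R V \o eval_dual.
have clU : closed (beta @` (~` U)).
  apply: compact_closed.
    by apply: hausdorff_product => v; exact: Rhausdorff.
  apply: continuous_compact.
    by apply: continuous_subspaceT; exact: eval_dual_ptws_continuous.
  by apply: (subclosed_compact _ (csys_compact hX)) => //; exact: open_closedC.
exists (@dual_eval R V @^-1` (~` (beta @` (~` U)))).
  apply: open_comp; last exact: closed_openC.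
  by move=> phi _; exact: initial_continuous.
rewrite predeqE => x; split=> [Ux [y nUy bxy]|nx].
  by apply: nUy; rewrite (eval_dual_ptws_injective bxy).
by apply: contrapT => nUx; apply: nx; exists x.
Qed.

End Representation.

Theorem theorem4p5 (R : realType) (S : topologicalMonoidType)
    (X : topologicalType) (act : S -> X -> X)
    (hX : compact_system act) (hC : circularly_ordered_system act) :
  Rosenthal_representable act R /\ tame act R.
Proof.
have [C [HC oC copS]] := hC; split; last first.
  exact: (circularly_ordered_tame HC oC (csys_compact hX) copS).
exists (bvspace R C); split; first exact: bvspace_Rosenthal.
exists (transl_Theta R hX HC copS), (@eval_dual R X C).
split; first exact: transl_representation.
exact: (eval_dual_embedding R hX HC oC).
Qed.
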